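(* Let $D$ be a simple derivation of $\Bbbk[x_1,\dots,x_n]$. Then the following are equivalent: (1) the ind-group $\operatorname{Aut}(D)$ is an algebraic group; (2) the ind-group $\operatorname{Aut}(D)$ is connected; (3) every element $\varphi\in\operatorname{Aut}(D)$ is algebraic; (4) every element $\varphi\in\operatorname{Aut}(D)$ is a locally finite automorphism; (5) every element $\varphi\in\operatorname{Aut}(D)$ is a unipotent locally finite automorphism.
   Context: $\Bbbk$ is an algebraically closed field of characteristic $0$. A derivation $D$ of $\Bbbk[x_1,\dots,x_n]$ is a $\Bbbk$-linear endomorphism with $D(fg)=D(f)g+fD(g)$; it is simple if the only ideals $I$ with $D(I)\subset I$ are the trivial ones. $\operatorname{Aut}(D)$ is the group of $\Bbbk$-algebra automorphisms $\varphi$ of $\Bbbk[x_1,\dots,x_n]$ with $\varphi D=D\varphi$. $\operatorname{Aut}(\Bbbk[x_1,\dots,x_n])$ is canonically identified with $\operatorname{Aut}(\mathbb A^n)$ and is an ind-group, with filtration $\operatorname{Aut}(\Bbbk[x_1,\dots,x_n])_p=\{\varphi=(f_1,\dots,f_n): \deg f_i\le p\ \forall i\}$, where $f_i=\varphi(x_i)$; closures and connectedness are with respect to the inductive topology. $\operatorname{Aut}(D)$ is a closed subgroup, hence an ind-group. A closed subgroup $G$ is algebraic if it is contained in some $\operatorname{Aut}(\Bbbk[x_1,\dots,x_n])_p$. An automorphism $\varphi$ is algebraic if the closure $\overline{\langle\varphi\rangle}$ of the group it generates is an algebraic group. A linear endomorphism $\varphi$ is locally finite if every element lies in a finite-dimensional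 $\varphi$-stable subspace; a locally finite automorphism $\varphi$ is unipotent if $\varphi-\mathrm{Id}$ is locally nilpotent. *)

(* Defs.v *)
From HB Require Import structures.
From mathcomp Require Import all_boot all_order all_algebra.
From mathcomp.multinomials Require Import mpoly.
From mathcomp Require Import boolp classical_sets topology.

Set Implicit Arguments.
Unset Strict Implicit.
Unset Printing Implicit Defensive.

Import GRing.Theory.

Local Open Scope classical_set_scope.
Local Open Scope ring_scope.

Definition is_derivation (n : nat) (k : fieldType)
    (D : {linear {mpoly k[n]} -> {mpoly k[n]}}) : Prop :=
  forall f g, D (f * g) = D f * g + f * D g.

(* The library's [idealr_closed] only covers boolean, proper ideals. *)
Definition is_ideal (R : comNzRingType) (I : set R) : Prop :=
  [/\ I 0, (forall u v, I u -> I v -> I (u + v))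
    & (forall a u, I u -> I (a * u))].

Definition is_simple (n : nat) (k : fieldType)
    (D : {linear {mpoly k[n]} -> {mpoly k[n]}}) : Prop :=
  forall I : set {mpoly k[n]}, is_ideal I -> D @` I `<=` I ->
    I = [set 0] \/ I = setT.

Record polyaut (n : nat) (k : fieldType) := PolyAut {
  polyaut_fun :> {lrmorphism {mpoly k[n]} -> {mpoly k[n]}};
  polyaut_bij : bijective polyaut_fun
}.

HB.instance Definition _ (n : nat) (k : fieldType) :=
  gen_eqMixin (polyaut n k).
HB.instance Definition _ (n : nat) (k : fieldType) :=
  gen_choiceMixin (polyaut n k).

Section PolyautGroup.
Variables (n : nat) (k : fieldType).
Local Notation P := {mpoly k[n]}.
Implicit Types phi psi : polyaut n k.

Lemma polyautP phi psi : phi =1 psi -> phi = psi.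
Proof.
case: phi psi => [[f cf] bf] [[g cg] bg] /= /funext fg; subst g.
have ecfg : cf = cg.
  case: cf cg {bf bg} => [[a1] [a2] [a3]] [[b1] [b2] [b3]].
  by rewrite (Prop_irrelevance a1 b1) (Prop_irrelevance a2 b2)
    (Prop_irrelevance a3 b3).
subst cg; congr PolyAut; exact: Prop_irrelevance.
Qed.

Definition polyaut1 : polyaut n k :=
  @PolyAut n k (idfun : P -> P) (Bijective (fun=> erefl) (fun=> erefl)).

Definition polyautM phi psi : polyaut n k :=
  @PolyAut n k (phi \o psi) (bij_comp (polyaut_bij phi) (polyaut_bij psi)).

Lemma polyaut_inv_ex phi : exists psi, cancel phi psi /\ cancel psi phi.
Proof.
have [g fK gK] := polyaut_bij phi.
pose g1 := GRing.isMonoidMorphism.Build P P g (can2_monoid_morphism fK gK).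
pose g2 := GRing.isLinear.Build k P P _ g (can2_linear fK gK).
pose G : {lrmorphism P -> P} := HB.pack g g1 g2.
by exists (@PolyAut n k G (Bijective gK fK)).
Qed.

Definition polyautV phi : polyaut n k := projT1 (cid (polyaut_inv_ex phi)).

Lemma polyautVK phi : cancel (polyautV phi) phi.
Proof. by rewrite /polyautV; case: cid => psi []. Qed.

Lemma polyautK phi : cancel phi (polyautV phi).
Proof. by rewrite /polyautV; case: cid => psi []. Qed.

Fact polyautMA : associative polyautM.
Proof. by move=> phi psi chi; apply: polyautP. Qed.

Fact polyaut1M : left_id polyaut1 polyautM.
Proof. by move=> phi; apply: polyautP. Qed.

Fact polyautM1 : right_id polyaut1 polyautM.
Proof. by move=> phi; apply: polyautP. Qed.

Fact polyautVM : left_inverse polyaut1 polyautV polyautM.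
Proof. by move=> phi; apply: polyautP => f /=; exact: polyautK. Qed.

Fact polyautMV : right_inverse polyaut1 polyautV polyautM.
Proof. by move=> phi; apply: polyautP => f /=; exact: polyautVK. Qed.

End PolyautGroup.

HB.instance Definition _ (n : nat) (k : fieldType) :=
  isGroup.Build (polyaut n k) (@polyautMA n k) (@polyaut1M n k) (@polyautM1 n k)
    (@polyautVM n k) (@polyautMV n k).

(* [msize f <= p.+1] means that f has total degree at most p. *)
Definition aut_deg (n : nat) (k : fieldType) (p : nat) : set (polyaut n k) :=
  [set phi | forall i : 'I_n, (msize (phi 'X_i) <= p.+1)%N].

(* Aut_p lies in the affine space of n-tuples of polynomials of degree at     *)
(* most p, whose coordinates are the coefficients of the n components; the    *)
(* pairs (component, monomial) are numbered by [enum_val].                    *)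
Definition coord_dim (n p : nat) : nat := #|{: 'I_n * 'X_{1..n < p.+1}}|.

Definition aut_coord (n : nat) (k : fieldType) (p : nat) (phi : polyaut n k)
    (j : 'I_(coord_dim n p)) : k :=
  let im := enum_val j in (phi 'X_(im.1))@_(im.2).

Definition zariski_closed_in_deg (n : nat) (k : fieldType) (p : nat)
    (A : set (polyaut n k)) : Prop :=
  exists S : set {mpoly k[coord_dim n p]},
    A = [set phi | aut_deg p phi /\
                   forall Q, S Q -> Q.@[@aut_coord n k p phi] = 0].

Definition ind_closed (n : nat) (k : fieldType) (A : set (polyaut n k)) : Prop :=
  forall p : nat, zariski_closed_in_deg p (A `&` @aut_deg n k p).

Section IndTopology.
Variables (n : nat) (k : fieldType).
Implicit Types (A B : set (polyaut n k)).

Fact ind_closed0 : ind_closed (set0 : set (polyaut n k)).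
Proof.
move=> p; exists [set 1]; rewrite set0I; apply/seteqP; split=> // phi [_].
by move=> /(_ 1 erefl) /eqP; rewrite meval1 oner_eq0.
Qed.

Fact ind_closedU A B : ind_closed A -> ind_closed B -> ind_closed (A `|` B).
Proof.
move=> cA cB p; have [S AS] := cA p; have [T BT] := cB p.
exists [set Q | exists2 U, S U & exists2 V, T V & Q = U * V].
rewrite setIUl AS BT; apply/seteqP; split=> phi /=.
  case=> -[dphi h]; split=> // _ [U SU [V TV ->]]; rewrite mevalM.
    by rewrite (h _ SU) mul0r.
  by rewrite (h _ TV) mulr0.
move=> [dphi h].
have [hS|] := pselect (forall Q, S Q -> Q.@[aut_coord phi] = 0); first by left.
move=> /existsNP [U /not_implyP [SU /eqP nU]]; right; split=> // V TV.
have /eqP := h (U * V) (ex_intro2 _ _ U SU (ex_intro2 _ _ V TV erefl)).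
by rewrite mevalM mulf_eq0 (negPf nU) => /eqP.
Qed.

Fact ind_closed_bigI (I : Type) (F : I -> set (polyaut n k)) :
  (forall i, ind_closed (F i)) -> ind_closed (\bigcap_i F i).
Proof.
move=> cF p; pose S i := projT1 (cid (cF i p)).
have FS i : F i `&` @aut_deg n k p = _ := projT2 (cid (cF i p)).
exists [set Q | exists i, S i Q]; apply/seteqP; split=> phi /=.
  move=> [Fphi dphi]; split=> // Q [i SQ].
  have : (F i `&` @aut_deg n k p) phi by split=> //; exact: Fphi.
  by rewrite FS => -[_]; apply.
move=> [dphi h]; split=> // i _.
suff : (F i `&` @aut_deg n k p) phi by case.
by rewrite FS; split=> // Q SQ; apply: h; exists i.
Qed.

Definition ind_open A := ind_closed (~` A).

Fact ind_openT : ind_open setT.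
Proof. by rewrite /ind_open setCT; exact: ind_closed0. Qed.

Fact ind_openI : setI_closed ind_open.
Proof. by move=> A B oA oB; rewrite /ind_open setCI; exact: ind_closedU. Qed.

Fact ind_open_bigU (I : Type) (F : I -> set (polyaut n k)) :
  (forall i, ind_open (F i)) -> ind_open (\bigcup_i F i).
Proof. by move=> oF; rewrite /ind_open setC_bigcup; exact: ind_closed_bigI. Qed.

End IndTopology.

HB.instance Definition _ (n : nat) (k : fieldType) :=
  isOpenTopological.Build (polyaut n k) (@ind_openT n k) (@ind_openI n k)
    (@ind_open_bigU n k).

Lemma closed_ind_closed (n : nat) (k : fieldType) (A : set (polyaut n k)) :
  closed A <-> ind_closed A.
Proof. by rewrite -openC -[A in ind_closed A]setCK. Qed.

Definition is_algebraic_group (n : nat) (k : fieldType)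
    (G : set (polyaut n k)) : Prop :=
  [/\ group_closed (mem G), closed G & exists p : nat, G `<=` @aut_deg n k p].

Definition gen_subgroup (n : nat) (k : fieldType) (phi : polyaut n k) :
    set (polyaut n k) :=
  [set psi | exists m : nat, psi = (phi ^+ m)%g \/ psi = (phi ^- m)%g].

Definition is_algebraic_aut (n : nat) (k : fieldType) (phi : polyaut n k) :
    Prop :=
  is_algebraic_group (closure (gen_subgroup phi)).

Definition AutD (n : nat) (k : fieldType)
    (D : {linear {mpoly k[n]} -> {mpoly k[n]}}) : set (polyaut n k) :=
  [set phi | forall f, phi (D f) = D (phi f)].

Section LocallyFinite.
Variables (k : fieldType) (V : lmodType k).
Implicit Types (W : set V) (phi : {linear V -> V}).

(* [{vspace V}] is not available, as V may be infinite dimensional. *)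
Definition fin_dim_subspace W : Prop :=
  exists (m : nat) (b : 'I_m -> V),
    W = [set v | exists c : 'I_m -> k, v = \sum_(i < m) c i *: b i].

Definition locally_finite phi : Prop :=
  forall v : V, exists W, [/\ fin_dim_subspace W, W v & phi @` W `<=` W].

Definition locally_nilpotent phi : Prop :=
  forall v : V, exists m : nat, iter m phi v = 0.

Definition unipotent phi : Prop :=
  locally_finite phi /\ locally_nilpotent (phi \- idfun).

End LocallyFinite.

(* Main.v *)
Require Import Defs.
From HB Require Import structures.
From mathcomp Require Import all_boot all_order all_algebra all_fingroup all_field.
From mathcomp.multinomials Require Import mpoly.
From mathcomp Require Import boolp classical_sets topology.
From mathcomp Require Import zify ring.

(* Write x0 for the origin. The polynomials whose iterated D-derivatives all  *)
(* vanish at x0 form a D-stable ideal, so for simple D a polynomial is known  *)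
(* from these numbers. As phi in Aut(D) satisfies                             *)
(* (D^j (phi f))(x0) = (D^j f)(phi(x0)), the coefficients of phi, once its    *)
(* degree is bounded by p, are polynomials in the point phi(x0) of k^n.       *)
(* Attach to an irreducible set X of elements of Aut(D) of bounded degree,    *)
(* with 1 in X, the prime ideal of k[x_1..x_n] of the functions vanishing on  *)
(* X(x0). Chains of primes have length at most n, so some X has a minimal     *)
(* ideal; then X and XY have the same ideal for any other Y of this kind, so  *)
(* every coefficient of high degree vanishes on XY as it does on X. Hence all *)
(* these sets have a common degree bound. Their union is closed under         *)
(* products, so an irreducible set of bounded degree in Aut(D) lies inside it *)
(* or misses it; by noetherianity it is then open and closed in Aut(D). This  *)
(* gives (2) => (1), and (5) => (1) because the powers of a unipotent phi     *)
(* form such a set.                                                           *)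
(* For (4) => (5): if phi in Aut(D) has an eigenvalue l, the eigenspace       *)
(* generates a D-stable ideal, so 1 = sum_j v_j u_j with phi u_j = l u_j.     *)
(* Specialize this identity, phi and its inverse to a finite field with q     *)
(* elements: the order e of the image of l divides the size of each orbit of  *)
(* phi on the q^n points, and it divides q - 1, so e = 1. Keeping l - 1       *)
(* nonzero under specialization shows l = 1.                                  *)

Set Implicit Arguments.
Unset Strict Implicit.
Unset Printing Implicit Defensive.

Import Order.TTheory GRing.Theory.

Local Open Scope classical_set_scope.
Local Open Scope ring_scope.

(** * Algebraic dependence and chains of primes *)

Section AlgebraicDependence.
Variable k : fieldType.

Lemma left_kernel_nontrivial m n (A : 'M[k]_(m, n)) :
  (n < m)%N -> exists2 v : 'rV_m, v != 0 & v *m A = 0.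
Proof.
move=> ltnm; have : kermx A != 0.
  by rewrite kermx_eq0 /row_free neq_ltn (leq_ltn_trans (rank_leq_col A)).
by case/rowV0Pn=> v /sub_kermxP vA v0; exists v.
Qed.

Lemma msize_mulS n (p q : {mpoly k[n]}) a b :
  (msize p <= a.+1)%N -> (msize q <= b.+1)%N -> (msize (p * q) <= (a + b).+1)%N.
Proof.
move=> pa qb; have [->|p0] := eqVneq p 0; first by rewrite mul0r msize0.
have [->|q0] := eqVneq q 0; first by rewrite mulr0 msize0.
rewrite msizeM // -subn1 leq_subLR (leq_trans (leq_add pa qb)) //; lia.
Qed.

Lemma msize_expS n (p : {mpoly k[n]}) a i :
  (msize p <= a.+1)%N -> (msize (p ^+ i) <= (i * a).+1)%N.
Proof.
move=> pa; elim: i => [|i IH]; first by rewrite expr0 msize1.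
by rewrite exprS mulSn; exact: msize_mulS.
Qed.

Lemma msize_prodS n (I : finType) (F : I -> {mpoly k[n]}) (a : I -> nat) :
  (forall i, msize (F i) <= (a i).+1)%N ->
  (msize (\prod_i F i) <= (\sum_i a i).+1)%N.
Proof.
move=> Fa; elim/big_rec2: _ => [|i b p _ pb]; first by rewrite msize1.
exact: msize_mulS.
Qed.

(** Dimension count: the products of powers of the [g i] with exponents below [d] have degree below
    [D], which is linear in [d], so for large [d] they outnumber the monomials in [n] variables with
    exponents below [D]. *)
Lemma algebraic_dependence n (g : 'I_n.+1 -> {mpoly k[n]}) :
  exists2 Q : {mpoly k[n.+1]}, Q != 0 & mmap (@mpolyC n k) g Q = 0.
Proof.
pose e := \max_i msize (g i).
have ge i : (msize (g i) <= e.+1)%N.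
  by apply: leq_trans (leqnSn _); exact: (leq_bigmax i).
(* As [D] is at most [(n.+1 * e).+1 * d], one gets [D ^ n <= c * d ^ n < d ^ n.+1]. *)
pose c := ((n.+1 * e).+1 ^ n)%N; pose d := c.+1.
pose D := (n.+1 * d * e).+1.
pose E := {ffun 'I_n.+1 -> 'I_d}; pose E' := {ffun 'I_n -> 'I_D}.
pose gm (a : E) := \prod_i g i ^+ a i.
have sz_gm a : (msize (gm a) <= D)%N.
  apply: leq_trans (msize_prodS (fun i => msize_expS (a i) (ge i))) _.
  rewrite ltnS -big_distrl /= leq_mul2r; apply/orP; right.
  apply: leq_trans (_ : \sum_(i < n.+1) d <= _)%N.
    by apply: leq_sum => i _; exact: ltnW.
  by rewrite sum_nat_const card_ord.
pose A : 'M[k]_(#|E|, #|E'|) :=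
  \matrix_(i, j) (gm (enum_val i))@_[multinom ((enum_val j : E') l : nat) | l < n].
have [|v v0 vA] := @left_kernel_nontrivial _ _ A.
  rewrite !card_ffun !card_ord expnS.
  apply: (@leq_ltn_trans (((n.+1 * e).+1 * d) ^ n)%N).
    by case: (posnP n) => [-> //|n0]; rewrite leq_exp2r // /D; nia.
  by rewrite expnMn ltn_mul2r expn_gt0 /= ltnSn.
pose mon (a : E) : 'X_{1..n.+1} := [multinom (a i : nat) | i < n.+1].
have mon_inj : injective mon.
  move=> a b /mnmP ab; apply/ffunP => i; apply/val_inj.
  by have := ab i; rewrite !mnmE.
pose Q := \sum_(i < #|E|) v 0 i *: 'X_[k, mon (enum_val i)].
have Qc i : Q@_(mon (enum_val i)) = v 0 i.
  rewrite raddf_sum (bigD1 i) //= big1 => [|j ji].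
    by rewrite mcoeffZ mcoeffX eqxx mulr1 addr0.
  rewrite mcoeffZ mcoeffX (inj_eq mon_inj) (inj_eq enum_val_inj) (negPf ji).
  by rewrite mulr0.
exists Q.
  apply: contra v0 => /eqP Q0; apply/eqP/rowP => i.
  by rewrite -Qc Q0 mcoeff0 mxE.
have -> : mmap (@mpolyC n k) g Q = \sum_(i < #|E|) v 0 i *: gm (enum_val i).
  rewrite raddf_sum; apply: eq_bigr => i _ /=.
  rewrite mmapZ mmapX mul_mpolyC; congr (_ *: _); rewrite /mmap1 /gm.
  by apply: eq_bigr => j _; rewrite mnmE.
apply/mpolyP => m; rewrite raddf_sum mcoeff0 /=.
case: (boolP [forall i, m i < D]%N) => [/forallP mD|].
  pose b : E' := [ffun i => Ordinal (mD i)].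
  have -> : m = [multinom ((enum_val (enum_rank b) : E') l : nat) | l < n].
    by apply/mnmP => i; rewrite mnmE enum_rankK ffunE.
  have /rowP/(_ (enum_rank b)) := vA; rewrite !mxE => vAb; rewrite -[RHS]vAb.
  by apply: eq_bigr => i _; rewrite mcoeffZ mxE.
case/forallPn => i; rewrite -leqNgt => Dm.
apply: big1 => j _; rewrite mcoeffZ memN_msupp_eq0 ?mulr0 //.
apply: msize_mdeg_ge; apply: leq_trans (sz_gm _) (leq_trans Dm _).
by rewrite mdegE (bigD1 i) //= leq_addr.
Qed.

End AlgebraicDependence.

Section PrimeChains.

(** Singling out the last variable turns a relation between [r.+1] elements into a univariate
    polynomial evaluated at the last one. *)
Lemma mmap_muni (R : comNzRingType) (A : comNzRingType) (c : {rmorphism R -> A}) r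
    (h : 'I_r.+1 -> A) (Q : {mpoly R[r.+1]}) :
  mmap c h Q =
    (map_poly (mmap c (fun i => h (widen_ord (leqnSn r) i))) (muni Q)).[h ord_max].
Proof.
rewrite muniE rmorph_sum horner_sum; apply: eq_bigr => m _ /=.
rewrite map_polyZ /= hornerZ map_polyXn hornerXn mmapZ mmapX -mulrA; congr (_ * _).
rewrite /mmap1 big_ord_recr /=; congr (_ * _).
by apply: eq_bigr => i _; rewrite mnmE.
Qed.

Lemma muni_inj (R : comNzRingType) r : injective (@muni r R).
Proof.
have id (Q : {mpoly R[r.+1]}) : mmap (@mpolyC r.+1 R) (fun i => 'X_i) Q = Q.
  rewrite [RHS]mpolyE; apply: eq_bigr => m _.
  by rewrite mul_mpolyC mmap1_id.
by move=> P Q PQ; rewrite -[P]id -[Q]id !mmap_muni PQ.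
Qed.

Variables (k : fieldType) (n : nat).
Local Notation P := {mpoly k[n]}.

Definition is_prime_ideal (I : set P) : Prop :=
  [/\ is_ideal I, ~ I 1 & forall f g, I (f * g) -> I f \/ I g].

(** Algebraic independence over [k] of the classes modulo [I]; the largest possible [r] plays the
    role of the dimension of the quotient. *)
Definition independent_mod (I : set P) r (g : 'I_r -> P) : Prop :=
  forall Q : {mpoly k[r]}, I (mmap (@mpolyC n k) g Q) -> Q = 0.

Lemma independent_mod_size (I : set P) r (g : 'I_r -> P) :
  is_ideal I -> independent_mod I g -> (r <= n)%N.
Proof.
move=> [I0 _ _] indg; rewrite leqNgt; apply/negP => ltnr.
pose w i := g (widen_ord ltnr i).
have [Q Q0 gQ] := algebraic_dependence w.
case/eqP: Q0.
(* [v] renames variables so that [Q] becomes a relation on all of [g]; [u] undoes the renaming and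
   sends the remaining variables to 0. *)
pose v (i : 'I_n.+1) : {mpoly k[r]} := 'X_(widen_ord ltnr i).
have vinj : mmap (@mpolyC r k) v Q = 0.
  apply: indg; rewrite (_ : mmap _ _ _ = mmap (@mpolyC n k) w Q); first by rewrite gQ.
  rewrite [X in mmap _ g X]/mmap raddf_sum [RHS]/mmap; apply: eq_bigr => m _ /=.
  rewrite rmorphM /= mmapC; congr (_ * _); rewrite /mmap1 rmorph_prod.
  by apply: eq_bigr => i _; rewrite rmorphXn /= mmapX mmap1U.
pose u (j : 'I_r) : {mpoly k[n.+1]} :=
  if insub (j : nat) is Some i then 'X_i else 0.
have : mmap (@mpolyC n.+1 k) u (mmap (@mpolyC r k) v Q) = Q.
  rewrite [RHS]mpolyE [X in mmap _ u X]/mmap raddf_sum; apply: eq_bigr => m _ /=.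
  rewrite rmorphM /= mmapC mul_mpolyC; congr (_ *: _).
  rewrite mpolyXE_id /mmap1 rmorph_prod; apply: eq_bigr => i _.
  by rewrite rmorphXn /= mmapX mmap1U /u /= valK.
by rewrite vinj rmorph0.
Qed.

(* A relation for [g] extended by [f] has its constant coefficient in [I],    *)
(* hence zero by independence, and [f] can be divided out because it is not   *)
(* in the prime [I'].                                                         *)
Lemma independent_mod_extend (I I' : set P) r (g : 'I_r -> P) f :
  is_ideal I -> is_prime_ideal I' -> I' `<=` I -> independent_mod I g ->
  I f -> ~ I' f -> exists g' : 'I_r.+1 -> P, independent_mod I' g'.
Proof.
move=> [I0 ID IM] [_ _ I'p] I'I indg If I'f.
pose g' (i : 'I_r.+1) := oapp g f (insub (i : nat)).
exists g' => Q; rewrite mmap_muni.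
have -> : g' ord_max = f by rewrite /g' insubF //= ltnn.
rewrite (_ : mmap _ _ = mmap (@mpolyC n k) g); last first.
  by congr (mmap _ _); apply/funext => i; rewrite /g' /= valK.
move=> I'Q; apply: muni_inj; rewrite muni0.
elim/poly_ind: (muni Q) I'Q => // p c IH.
rewrite rmorphD rmorphM /= map_polyX map_polyC /= hornerD hornerM hornerX hornerC.
move=> I'pc; have c0 : c = 0.
  apply: indg; have /ID/(_ (IM (- (map_poly (mmap (@mpolyC n k) g) p).[f]) f If)) := I'I _ I'pc.
  by rewrite mulNr addrAC subrr add0r.
move: I'pc; rewrite c0 !rmorph0 !addr0 => /I'p[/IH ->|//].
by rewrite mul0r.
Qed.

End PrimeChains.

(** * The Hilbert basis theorem *)

Section HilbertBasis.

(** Each new index is one where the remaining tail attains its minimum. *)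
Lemma nondecreasing_subsequence (a : nat -> nat) :
  exists s : nat -> nat, {homo s : i j / (i < j)%N} /\ {homo a \o s : i j / (i <= j)%N}.
Proof.
have min_tail i : exists j, (i <= j)%N /\ forall l, (i <= l)%N -> (a j <= a l)%N.
  have [v] : exists v, exists2 j, (i <= j)%N & a j = v by exists (a i), i.
  elim/ltn_ind: v => v IH [j ij aj].
  have [[l il lv]|nl] := pselect (exists2 l, (i <= l)%N & (a l < v)%N).
    by apply: IH lv _; exists l.
  exists j; split=> // l il; rewrite leqNgt aj; apply/negP => lv.
  by apply: nl; exists l.
pose m i := projT1 (cid (min_tail i)).
have mP i : (i <= m i)%N /\ forall l, (i <= l)%N -> (a (m i) <= a l)%N.
  exact: projT2 (cid (min_tail i)).
pose fix s i := if i is i'.+1 then m (s i').+1 else m 0%N.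
have sS i : (s i < s i.+1)%N by exact: (mP _).1.
have s_lt : {homo s : i j / (i < j)%N} by apply: homo_ltn => //; exact: ltn_trans.
exists s; split=> //; apply: homo_leq => [//|x y z|i /=]; first exact: leq_trans.
case: i => [|i]; first exact: (mP _).2.
apply: (mP _).2; apply: leq_trans (sS i) (ltnW (sS i.+1)).
Qed.

(** Subsequences are extracted to make one coordinate after another nondecreasing; [l] counts the
    coordinates already treated. *)
Lemma dickson n (u : nat -> 'X_{1..n}) :
  exists i j, (i < j)%N /\ (u i <= u j)%MM.
Proof.
suff /(_ n) [s [s_lt su]] : forall l, exists s : nat -> nat,
    {homo s : i j / (i < j)%N} /\
    forall c : 'I_n, (c < l)%N -> {homo (fun i => u (s i) c) : i j / (i <= j)%N}.
  exists (s 0%N), (s 1%N); split; first exact: s_lt.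
  by apply/mnm_lepP => c; apply: (su c).
elim=> [|l [s [s_lt su]]]; first by exists id; split=> [i j|c]; rewrite ?ltn0.
have [ln|nl] := ltnP l n; last first.
  by exists s; split=> // c _; apply: su; exact: leq_trans (ltn_ord c) nl.
have [t [t_lt ut]] := nondecreasing_subsequence (fun i => u (s i) (Ordinal ln)).
exists (s \o t); split=> [i j ij|c]; first exact/s_lt/t_lt.
rewrite ltnS leq_eqVlt => /predU1P[cl|cl] i j ij /=.
  by rewrite (_ : c = Ordinal ln); [exact: ut | exact: val_inj].
apply: su => //; move: ij; rewrite leq_eqVlt => /predU1P[-> //|ij].
exact/ltnW/t_lt.
Qed.

Variables (k : fieldType) (n : nat).
Local Notation P := {mpoly k[n]}.

(** If all inclusions were strict, take [f j] in [I j.+1] outside [I j] with least leading monomial.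
    By [dickson] some [mlead (f i)] with [i < j] divides [mlead (f j)]; subtracting a multiple of
    [f i], which lies in [I j], cancels the leading term and contradicts minimality. *)
Lemma ascending_ideals_stabilize (I : nat -> set P) :
  (forall j, is_ideal (I j)) -> (forall j, I j `<=` I j.+1) ->
  exists j, I j.+1 `<=` I j.
Proof.
move=> idI incI; apply: contrapT => /forallNP strict.
have minf j : exists f, [/\ I j.+1 f, ~ I j f
    & forall g, I j.+1 g -> ~ I j g -> (mlead f <= mlead g)%O].
  have /existsNP[f0 /not_implyP[If0 nf0]] := strict j.
  have [m] : exists m, exists f, [/\ I j.+1 f, ~ I j f & mlead f = m].
    by exists (mlead f0), f0.
  elim/(well_founded_ind (@ltom_wf n)): m => m IH [f [If nf fm]].
  have [[g [Ig ng gf]]|nog] :=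
      pselect (exists g, [/\ I j.+1 g, ~ I j g & (mlead g < m)%O]).
    by apply: IH gf _; exists g.
  exists f; split=> // g Ig ng; rewrite fm leNgt; apply/negP => gm.
  by apply: nog; exists g.
pose f j := projT1 (cid (minf j)).
have fP j : [/\ I j.+1 (f j), ~ I j (f j)
    & forall g, I j.+1 g -> ~ I j g -> (mlead (f j) <= mlead g)%O].
  exact: projT2 (cid (minf j)).
have [i [j [ij ifj]]] := dickson (fun j => mlead (f j)).
have incIle a b : (a <= b)%N -> I a `<=` I b.
  by move=> /subnK <-; elim: (b - a)%N => // d IH g /IH; exact: incI.
have [If nf minfj] := fP j; have [Ifi nfi _] := fP i.
have neq0 l : f l != 0.
  by apply/eqP => f0; have [_ + _] := fP l; rewrite f0; have [+ _ _] := idI l.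
set m := (mlead (f j) - mlead (f i))%MM.
set c := mleadc (f j) / mleadc (f i).
pose q := c *: ('X_[m] * f i).
have ci0 : mleadc (f i) != 0 by rewrite mleadc_eq0.
have cj0 : mleadc (f j) != 0 by rewrite mleadc_eq0.
have c0 : c != 0 by rewrite mulf_neq0 ?invr_neq0.
have X0 : 'X_[m] != 0 :> P.
  by apply/eqP => /(congr1 (mcoeff m)); rewrite mcoeffX eqxx mcoeff0 => /eqP; rewrite oner_eq0.
have leadq : mlead q = mlead (f j).
  by rewrite mleadZ // mleadM // mleadXm submK.
have leadcq : q@_(mlead (f j)) = mleadc (f j).
  rewrite mcoeffZ -[X in _@_X](submK ifj) -/m ['X_[m] * _]mulrC mcoeffMX.
  by rewrite mulfVK.
have Iq : I j q.
  have [_ _ IM] := idI j; rewrite /q -mul_mpolyC.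
  by apply/IM/IM/(incIle i.+1).
have [_ ID IM] := idI j.
have [_ IDS IMS] := idI j.+1.
have Nq : I j.+1 (- q) by rewrite -mulN1r; apply/IMS/incI.
have h1 : I j.+1 (f j - q) by apply: IDS.
have h2 : ~ I j (f j - q) by move=> /ID/(_ Iq); rewrite subrK.
have := minfj _ h1 h2.
have hle : (mlead (f j - q) <= mlead (f j))%O.
  by apply: le_trans (mleadB_le _ _) _; rewrite leadq joinxx.
move=> hge; have hE : mlead (f j - q) = mlead (f j) by apply/le_anti; rewrite hle hge.
have /eqP : mleadc (f j - q) = 0 by rewrite hE mcoeffB leadcq subrr.
rewrite mleadc_eq0 => /eqP h0; apply: h2; rewrite h0.
by have [] := idI j.
Qed.

End HilbertBasis.

(** * Specialization to finite fields *)

Section FiniteSpecialization.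

(** Every element lies in a finite field, so [K] is an algebraic closure of the field with [p]
    elements. *)
Definition frobenius_periodic (p : nat) (K : closedFieldType) : Prop :=
  p \in [pchar K] /\ forall x : K, exists2 d, (0 < d)%N & x ^+ (p ^ d) = x.

Lemma frobenius_iter_inj (K : fieldType) p : p \in [pchar K] ->
  forall i (x y : K), x ^+ (p ^ i) = y ^+ (p ^ i) -> x = y.
Proof.
move=> cp; elim=> [|i IH] x y; first by rewrite expn0 !expr1.
rewrite expnSr !exprM => /(fmorph_inj (pFrobenius_aut cp)); exact: IH.
Qed.

(** If [x] is a root of [q] over the prime field, the iterated Frobenius images of [x] are values at
    [x] of remainders modulo [q]. There are finitely many remainders, so two images agree, and
    Frobenius is injective. *)
Lemma frobenius_periodic_closure p : prime p ->
  exists K : closedFieldType, frobenius_periodic p K.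
Proof.
move=> p_pr; have [K [f intK]] := countable_algebraic_closure 'F_p.
exists K; have cp : p \in [pchar K].
  by rewrite (fmorph_pchar f) pchar_Fp.
split=> // x; have [q q_mon qx] := intK x.
pose T := 'rV['F_p]_(size q).
pose h (i : 'I_#|T|.+1) : T := poly_rV ('X^(p ^ i) %% q).
have q0 : q != 0 by exact: monic_neq0.
have hE i : (map_poly f (rVpoly (h i))).[x] = x ^+ (p ^ i).
  rewrite poly_rV_K; last by rewrite ltnW // ltn_modp.
  have /(congr1 (fun r => (map_poly f r).[x])) := divp_eq 'X^(p ^ i) q.
  rewrite rmorphD rmorphM /= map_polyXn hornerD hornerM hornerXn => ->.
  by move/rootP: qx => ->; rewrite mulr0 add0r.
have /injectivePn[i [j ij hij]] : ~~ injectiveb h.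
  by apply/injectiveP => /leq_card; rewrite card_ord ltnn.
wlog ltij : i j ij hij / (i < j)%N => [W|].
  have [ij'|ji|/val_inj eqij] := ltngtP i j; first exact: (W i j).
    by apply: (W j i) => //; rewrite eq_sym.
  by rewrite eqij eqxx in ij.
exists (j - i)%N; first by rewrite subn_gt0.
apply: (frobenius_iter_inj cp (i := i)).
by rewrite -exprM -expnD subnK ?(ltnW ltij) // -!hE hij.
Qed.

Variable k : fieldType.

(** As [e] kills the kernel of [a], it amounts to a homomorphism to [K] from the subring [a(R)] of
    [k], keeping a prescribed nonzero element nonzero. *)
Definition specializable (R : idomainType) : Prop :=
  forall (a : {rmorphism R -> k}) (b : R), a b != 0 ->
  exists (p : nat) (K : closedFieldType) (e : {rmorphism R -> K}),
    [/\ frobenius_periodic p K, forall c, a c = 0 -> e c = 0 & e b != 0].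

(** In characteristic 0 the map [a] is injective, and reduction modulo a prime larger than the
    absolute value of [b] keeps [b] nonzero. *)
Lemma specializable_int : [pchar k] =i pred0 -> specializable int.
Proof.
move=> /pcharf0P k0 a b ab.
have a0 c : (a c == 0) = (c == 0).
  rewrite -[c in a c]intz rmorph_int; case: c => c.
    by rewrite -pmulrn k0.
  by rewrite NegzE mulrNz oppr_eq0 -pmulrn k0.
have [p ltbp p_pr] := prime_above `|b|%N.
have [K K_per] := frobenius_periodic_closure p_pr.
exists p, K, (intmul 1); split=> // [c /eqP|]; first by rewrite a0 => /eqP ->.
have [cp _] := K_per.
have b_gt0 : (0 < `|b|)%N by rewrite absz_gt0 -a0.
suff : (`|b|%N%:R : K) != 0.
  by case: (b) => n //; rewrite NegzE abszN /= mulrNz oppr_eq0.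
by rewrite -(dvdn_pcharf cp) gtnNdvd.
Qed.

(* If X maps to an element algebraic over the image of R, let g be a relation *)
(* of minimal degree: it is enough to send X to a root of the image of g and  *)
(* to keep the leading coefficient of g nonzero, together with one nonzero    *)
(* multiple of b coming from R, which a pseudo-division of g provides.        *)
Lemma specializable_poly (R : idomainType) :
  specializable R -> specializable {poly R}.
Proof.
move=> specR a b ab.
have [a0 a0C] : exists a0 : {rmorphism R -> k}, forall r, a0 r = a r%:P.
  by exists (a \o polyC).
pose c := a 'X.
have aE q : a q = (map_poly a0 q).[c].
  elim/poly_ind: q => [|q d IH]; first by rewrite !rmorph0 horner0.
  by rewrite !rmorphD !rmorphM /= map_polyX map_polyC hornerD hornerM hornerX hornerC IH -a0C.
(* Drops the top coefficients of [q] that vanish in [k], so that its formal degree is the degree of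
   its image. *)
have trunc q : exists q', map_poly a0 q' = map_poly a0 q /\
    size (map_poly a0 q') = size q'.
  exists (\poly_(i < size (map_poly a0 q)) q`_i).
  have E : map_poly a0 (\poly_(i < size (map_poly a0 q)) q`_i) = map_poly a0 q.
    apply/polyP => i; rewrite coef_map coef_poly.
    case: ltnP => [_|/leq_sizeP/(_ i (leqnn i)) ->]; last exact: rmorph0.
    by rewrite coef_map.
  split=> //; apply/eqP; rewrite eqn_leq size_poly /=.
  by rewrite E size_poly.
have ext (K : closedFieldType) (e0 : {rmorphism R -> K}) (x : K) :
    exists e : {rmorphism {poly R} -> K}, forall q, e q = (map_poly e0 q).[x].
  have cx : commr_rmorph e0 x by move=> y; exact: mulrC.
  by exists (horner_morph cx).
have kerE (K : closedFieldType) (e0 : {rmorphism R -> K}) q :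
    (forall r, a0 r = 0 -> e0 r = 0) -> map_poly a0 q = 0 -> map_poly e0 q = 0.
  move=> ke0 /polyP q0; apply/polyP => i; rewrite coef_map coef0; apply: ke0.
  by have := q0 i; rewrite coef_map coef0.
(* When [a 'X] is transcendental over the image of [R], it suffices to keep one coefficient of [b]
   nonzero and to send ['X] to a non-root of the image of [b]. *)
have [[g0 ag0 g00]|tr] := pselect (exists2 g, a g = 0 & map_poly a0 g != 0);
    last first.
  have b_neq0 : map_poly a0 b != 0.
    by apply: contra ab; rewrite aE => /eqP ->; rewrite horner0.
  set i := (size (map_poly a0 b)).-1.
  have a0b : a0 b`_i != 0 by rewrite -coef_map -lead_coefE lead_coef_eq0.
  have [p [K [e0 [K_per ke0 e0b]]]] := specR a0 _ a0b.
  have e0b0 : map_poly e0 b != 0.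
    by apply: contra e0b => /eqP/polyP/(_ i); rewrite coef_map coef0 => ->.
  have [x bx] := closed_nonrootP _ e0b0.
  have [e eE] := ext K e0 x; exists p, K, e; split=> // [q aq|]; last by rewrite eE.
  rewrite eE (kerE _ e0 q) ?horner0 //; apply: contrapT => /eqP q0.
  by apply: tr; exists q.
pose good_g m := `[<exists g, [/\ a g = 0, map_poly a0 g != 0 & size g = m]>].
have ex_g : exists m, good_g m by exists (size g0); apply/asboolP; exists g0.
case: (ex_minnP ex_g) => m /asboolP[g [ag g_neq0 gm]] g_min.
have {g_min} g_min q : a q = 0 -> (size q < size g)%N -> map_poly a0 q = 0.
  move=> aq; rewrite gm ltnNge => qg; apply: contrapT => /eqP q0.
  by move/negP: qg; apply; apply: g_min; apply/asboolP; exists q.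
have lc_neq0 q : map_poly a0 q != 0 -> size (map_poly a0 q) = size q ->
    a0 (lead_coef q) != 0.
  by move=> q0 sq; rewrite lead_coefE -sq -coef_map -lead_coefE lead_coef_eq0.
have sg : size (map_poly a0 g) = size g.
  have [g' [gE sg']] := trunc g.
  apply/eqP; rewrite eqn_leq size_poly /= leqNgt -gE sg'; apply/negP => lt.
  by move: g_neq0; rewrite -gE g_min ?eqxx // aE gE -aE.
have lcg := lc_neq0 g g_neq0 sg.
have g_gt1 : (1 < size g)%N.
  rewrite ltnNge; apply/negP => /size1_polyC gC.
  by move: ag g_neq0; rewrite gC map_polyC /= -a0C => ->; rewrite polyC0 eqxx.
have aZ r q : a (r *: q) = a0 r * a q by rewrite -mul_polyC rmorphM -a0C.
(* [b'] represents a nonzero multiple of [b] and has least size; it will turn out to be constant. *)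
pose good_b m := `[<exists b' u, [/\ a b' = a (u * b), a b' != 0 & size b' = m]>].
have ex_b : exists m, good_b m.
  by exists (size b); apply/asboolP; exists b, 1; rewrite mul1r.
case: (ex_minnP ex_b) => m' /asboolP[b' [u [ab' ab'0 bm]]] b_min.
have {b_min} b_min q v : a q = a (v * b) -> (size q < size b')%N -> a q = 0.
  move=> aq; rewrite bm ltnNge => qb; apply: contrapT => /eqP q0.
  by move/negP: qb; apply; apply: b_min; apply/asboolP; exists q, v.
have b'0 : b' != 0 by apply: contra ab'0 => /eqP ->; rewrite rmorph0.
have g0_neq : g != 0 by rewrite -size_poly_gt0 ltnW.
have sb'g : (size b' < size g)%N.
  rewrite ltnNge; apply/negP => gb.
  have /(congr1 a) := Pdiv.WeakIdomain.divp_eq b' g; rewrite aZ rmorphD rmorphM /= ag mulr0 add0r.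
  set s := lead_coef g ^+ _ => E.
  have : a (b' %% g) = 0.
    apply: (b_min _ (s *: u)).
      by rewrite -E ab' -scalerAl aZ.
    by apply: leq_trans gb; rewrite ltn_modp.
  rewrite -E => /eqP; rewrite mulf_eq0 (negPf ab'0) orbF rmorphXn expf_eq0.
  by rewrite (negPf lcg) andbF.
have b'_neq0 : map_poly a0 b' != 0.
  by apply: contra ab'0; rewrite aE => /eqP ->; rewrite horner0.
(* If [b'] had positive degree, pseudo-dividing [g] by it would give a quotient and a remainder
   killed by [a] and shorter than [g]. Their images over [k] would vanish, hence also that of
   [g]. *)
have [b1|] := leqP (size b') 1; last first.
  move=> b'_gt1.
  have /(congr1 a) := Pdiv.WeakIdomain.divp_eq g b'; rewrite aZ ag mulr0 rmorphD rmorphM /=.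
  move=> /esym/eqP; rewrite addr_eq0 => /eqP E.
  have ar : a (g %% b') = 0.
    apply: (b_min _ (- (g %/ b' * u))); last by rewrite ltn_modp.
    by rewrite mulNr rmorphN -mulrA rmorphM -ab' E opprK.
  have aq : a (g %/ b') = 0.
    by apply/eqP; move/eqP: E; rewrite ar oppr0 mulf_eq0 (negPf ab'0) orbF.
  have sb' : size (map_poly a0 b') = size b'.
    have [b2 [bE sb2]] := trunc b'.
    apply/eqP; rewrite eqn_leq size_poly /= leqNgt -bE sb2; apply/negP => lt.
    have ab2 : a b2 = a b' by rewrite !aE bE.
    by move: ab'0; rewrite -ab2 (b_min b2 u) ?eqxx // ab2.
  have : map_poly a0 (lead_coef b' ^+ scalp g b' *: g) = 0.
    rewrite Pdiv.WeakIdomain.divp_eq rmorphD rmorphM /= g_min // ?mul0r ?add0r.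
      by apply: g_min => //; apply: ltn_trans sb'g; rewrite ltn_modp.
    by rewrite size_divp //; lia.
  move/eqP; rewrite map_polyZ /= scaler_eq0 (negPf g_neq0) orbF rmorphXn expf_eq0.
  by rewrite (negPf (lc_neq0 b' b'_neq0 sb')) andbF.
have b'C := size1_polyC b1.
have a0b : a0 b'`_0 != 0 by move: ab'0; rewrite b'C -a0C coefC eqxx.
have [|p [K [e0 [K_per ke0]]]] := specR a0 (lead_coef g * b'`_0).
  by rewrite rmorphM mulf_neq0.
rewrite rmorphM mulf_eq0 negb_or => /andP[e0g e0b].
have [x gx] : exists x, root (map_poly e0 g) x.
  apply/closed_rootP; rewrite size_poly_eq // gtn_eqF //.
have [e eE] := ext K e0 x.
have eC r : e r%:P = e0 r by rewrite eE map_polyC hornerC.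
have ke q : a q = 0 -> e q = 0.
  move=> aq; have := Pdiv.WeakIdomain.divp_eq q g; set s := lead_coef g ^+ _ => E.
  have ar : a (q %% g) = 0.
    move/(congr1 a)/esym: E.
    by rewrite aZ aq mulr0 rmorphD rmorphM /= ag mulr0 add0r.
  have er : e (q %% g) = 0.
    rewrite eE (kerE _ e0 (q %% g)) ?horner0 //.
    by apply: g_min => //; rewrite ltn_modp.
  move/(congr1 e): E; rewrite -mul_polyC rmorphD !rmorphM /= er addr0.
  have -> : e g = 0 by rewrite eE; apply/rootP.
  move/eqP; rewrite mulr0 mulf_eq0 eC rmorphXn expf_eq0 (negPf e0g) andbF /=.
  by move/eqP.
exists p, K, e; split=> //.
have /eqP : e (u * b - b') = 0 by apply: ke; rewrite rmorphB /= ab' subrr.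
rewrite rmorphB rmorphM /= subr_eq0 b'C eC => /eqP E.
by apply: contra e0b => /eqP eb; rewrite -E eb mulr0.
Qed.

(** One polynomial variable over [int] is adjoined for each constant of the list. *)
Lemma specializable_lift : [pchar k] =i pred0 -> forall cs : seq k,
  exists (R : idomainType) (a : {rmorphism R -> k}),
    specializable R /\ {subset cs <= [pred c | `[<exists r, a r = c>]]}.
Proof.
move=> k0; elim=> [|c cs [R [a [specR lift]]]].
  by exists int, (intmul 1); split=> //; exact: specializable_int.
have ac : commr_rmorph a c by move=> y; exact: mulrC.
exists {poly R}, (horner_morph ac); split; first exact: specializable_poly.
move=> d; rewrite inE => /predU1P[->|/lift/asboolP[r <-]]; apply/asboolP.
  by exists 'X; exact: horner_morphX.
by exists r%:P; exact: horner_morphC.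
Qed.

End FiniteSpecialization.

Section CountingPoints.

(** The size of an orbit is a return time of its points, and [A] is a disjoint union of orbits. *)
Lemma dvdn_card_orbits (T : finType) (s : {perm T}) (A : {set T}) e :
  (forall z, z \in A -> s z \in A) ->
  (forall z i, z \in A -> iter i s z = z -> (e %| i)%N) ->
  (e %| #|A|)%N.
Proof.
move=> sA eA; have actsA : [acts <[s]>%g, on A | 'P].
  rewrite cycle_subG !inE /=; apply/fintype.subsetP => z zA.
  by rewrite inE /=; exact: sA.
rewrite -(acts_sum_card_orbit actsA); apply: dvdn_sum => _ /imsetP[z zA ->].
by rewrite -porbitE; exact: eA zA (iter_porbit s z).
Qed.

Lemma frobenius_common_period p (K : closedFieldType) (cs : seq K) :
  frobenius_periodic p K ->
  exists2 d, (0 < d)%N & forall c, c \in cs -> c ^+ (p ^ d) = c.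
Proof.
move=> [_ perK].
have iterF (x : K) d e : x ^+ (p ^ d) = x -> x ^+ (p ^ (d * e)) = x.
  by move=> xd; elim: e => [|e IH]; rewrite ?muln0 ?expr1 // mulnS expnD exprM xd.
elim: cs => [|c cs [d d0 dP]]; first by exists 1%N.
have [e e0 ce] := perK c; exists (d * e)%N; first by rewrite muln_gt0 d0.
move=> b; rewrite inE => /predU1P[->|/dP/iterF //].
by rewrite mulnC iterF.
Qed.

Lemma eigenvalue_eq1_frobenius p (K : closedFieldType) n
    (f g : 'I_n -> {mpoly K[n]}) (l : K) r (u v : 'I_r -> {mpoly K[n]}) :
  frobenius_periodic p K ->
  (forall i, mmap (@mpolyC n K) f (g i) = 'X_i) ->
  (forall j, mmap (@mpolyC n K) f (u j) = l *: u j) ->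
  \sum_j v j * u j = 1 -> l = 1.
Proof.
move=> perK fg fu vu.
have evf (h : {mpoly K[n]}) (x : 'I_n -> K) :
    (mmap (@mpolyC n K) f h).@[x] = h.@[fun i => (f i).@[x]].
  rewrite {1}/mmap raddf_sum mevalE; apply: eq_bigr => m _ /=.
  rewrite mevalM mevalC; congr (_ * _); rewrite /mmap1 rmorph_prod.
  by apply: eq_bigr => i _; rewrite rmorphXn.
have u_neq0 (x : 'I_n -> K) : exists j, (u j).@[x] != 0.
  apply: contrapT => /forallNP u0.
  have /(congr1 (meval x)) := vu; rewrite meval1 raddf_sum big1 => [/eqP|j _].
    by rewrite eq_sym oner_eq0.
  rewrite /= mevalM; have /negP := u0 j; rewrite negbK => /eqP ->.
  by rewrite mulr0.
(* The finite field must contain [l] and all coefficients of [f], so that [f] acts on its points. *)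
pose cs := l :: flatten [seq [seq (f i)@_m | m <- msupp (f i)] | i <- enum 'I_n].
have [d d0 dP] := frobenius_common_period cs perK.
have [cp _] := perK.
set q := (p ^ d)%N in dP.
have q_gt1 : (1 < q)%N.
  by rewrite -(expn0 p) ltn_exp2l // prime_gt1 // (pcharf_prime cp).
have FD (x y : K) : (x + y) ^+ q = x ^+ q + y ^+ q.
  by apply: exprDn_pchar; rewrite (eq_pnat _ (pcharf_eq cp)) pnatX pnat_id // (pcharf_prime cp).
have [rs rsE] := closed_field_poly_normal ('X^q - 'X : {poly K}).
have szq : size ('X^q - 'X : {poly K}) = q.+1.
  by rewrite size_polyDl size_polyXn // size_polyN size_polyX ltnS.
have memS x : (x \in undup rs) = (x ^+ q == x).
  rewrite mem_undup -root_prod_XsubC -subr_eq0.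
  have -> : x ^+ q - x = ('X^q - 'X).[x] by rewrite hornerD hornerN hornerXn hornerX.
  rewrite -/(root _ x) rsE rootZ // lead_coef_eq0 -size_poly_gt0 szq //.
(* The fixed points of the [q]-th power map. The size of [S] is never computed: it is enough to
   compare it with the number of nonzero elements. *)
pose S := seq_sub (undup rs).
have Sval (x : S) : val x ^+ q = val x by apply/eqP; rewrite -memS; exact: valP.
have evS (h : {mpoly K[n]}) (x : 'I_n -> S) : (forall m, m \in msupp h -> h@_m ^+ q = h@_m) ->
    h.@[fun i => val (x i)] \in undup rs.
  move=> hq; rewrite memS mevalE; apply/eqP.
  rewrite big_seq; elim/big_ind: _ => [|a b qa qb|m mh].
  - by rewrite expr0n gtn_eqF // ltnW.
  - by rewrite FD qa qb.
  rewrite exprMn hq // -prodrXl; congr (_ * _); apply: eq_bigr => i _.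
  by rewrite -exprM mulnC exprM Sval.
have fS i (x : 'I_n -> S) : (f i).@[fun i => val (x i)] \in undup rs.
  apply: evS => m mf; apply: dP; rewrite inE; apply/orP; right.
  apply/flattenP; exists [seq (f i)@_m | m <- msupp (f i)].
    by apply: map_f; rewrite mem_enum.
  exact: map_f.
pose Z := {ffun 'I_n -> S}.
pose F (x : Z) : Z := [ffun i => SeqSub (fS i x)].
have evF (h : {mpoly K[n]}) (x : Z) :
    (mmap (@mpolyC n K) f h).@[fun i => val (x i)] = h.@[fun i => val (F x i)].
  by rewrite evf; apply: meval_eq => i; rewrite ffunE.
have F_inj : injective F.
  move=> x y xy; apply/ffunP => i; apply/val_inj.
  have E (z : Z) : val (z i) = (g i).@[fun i => val (F z i)].
    by rewrite -evF fg mevalXU.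
  by rewrite E xy -E.
have lq : l ^+ q = l by apply: dP; rewrite mem_head.
have S0 : 0 \in undup rs by rewrite memS expr0n gtn_eqF // ltnW.
have l0 : l != 0.
  apply/eqP => l0; pose x : Z := [ffun=> SeqSub S0].
  have [j /eqP] := u_neq0 (fun i => val (F x i)); apply.
  by rewrite -evF fu l0 scale0r meval0.
have lq1 : l ^+ q.-1 = 1.
  apply: (mulfI l0); rewrite mulr1 -exprS prednK //; exact: ltnW.
have [|e e_prim _] := prim_order_exists _ lq1; first by rewrite -subn1 subn_gt0.
have dvdZ : (e %| #|{: S}| ^ n)%N.
  have -> : (#|{: S}| ^ n = #|[set: Z]%SET|)%N by rewrite cardsT card_ffun card_ord.
  apply: (dvdn_card_orbits (s := perm F_inj)) => [z _|z i _ ziz].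
    by rewrite inE.
  (* Some [u j] is nonzero at [z], and each step along the orbit multiplies its value by [l]; a
     return after [i] steps forces [l ^+ i = 1]. *)
  have [j uj] := u_neq0 (fun i => val (z i)).
  rewrite (prim_order_dvd e_prim); apply/eqP/(mulIf uj); rewrite mul1r.
  rewrite -[in RHS]ziz; elim: (i) => [|i' IH]; first by rewrite expr0 mul1r.
  by rewrite exprS -mulrA IH /= permE -evF fu mevalZ.
have lS (x : S) : l * val x \in undup rs by rewrite memS exprMn lq Sval.
pose L (x : S) : S := SeqSub (lS x).
have L_inj : injective L.
  by move=> x y /(congr1 val) /= /(mulfI l0)/val_inj.
pose o : S := SeqSub S0.
have dvdS : (e %| #|[set~ o]%SET|)%N.
  have nz x : (x \in [set~ o]%SET) = (val x != 0) by rewrite !inE -val_eqE.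
  apply: (dvdn_card_orbits (s := perm L_inj)) => [z|z i].
    by rewrite !nz permE /= mulf_eq0 (negPf l0).
  rewrite nz => z0 ziz; rewrite (prim_order_dvd e_prim).
  apply/eqP/(mulIf z0); rewrite mul1r -[in RHS]ziz.
  elim: (i) => [|i' IH]; first by rewrite expr0 mul1r.
  by rewrite exprS -mulrA IH /= permE.
have cardS : (#|{: S}| = #|[set~ o]%SET|.+1)%N.
  by rewrite cardsC1 prednK //; apply/card_gt0P; exists o.
have : coprime e (#|{: S}| ^ n)%N.
  apply: coprimeXr; apply: (coprime_dvdl dvdS); rewrite cardS; exact: coprimenS.
rewrite /coprime (gcdn_idPl dvdZ) => /eqP e1.
by have := prim_expr_order e_prim; rewrite e1.
Qed.

End CountingPoints.

Section EigenvalueOne.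

Lemma map_mpoly_mmap (R S : comNzRingType) (a : {rmorphism R -> S}) m n
    (f : 'I_m -> {mpoly R[n]}) (h : {mpoly R[m]}) :
  map_mpoly a (mmap (@mpolyC n R) f h) =
    mmap (@mpolyC n S) (fun i => map_mpoly a (f i)) (map_mpoly a h).
Proof.
have -> : map_mpoly a h = \sum_(i <- msupp h) a h@_i *: 'X_[i].
  rewrite [in LHS](mpolyE h) raddf_sum; apply: eq_bigr => i _ /=.
  by rewrite map_mpolyZ map_mpolyX.
rewrite {1}/mmap !raddf_sum; apply: eq_bigr => i _ /=.
rewrite mmapZ mmapX rmorphM /= map_mpolyC; congr (_ * _).
by rewrite /mmap1 rmorph_prod; apply: eq_bigr => j _; rewrite rmorphXn.
Qed.

Lemma map_mpoly_eq0 (R S S' : comNzRingType) (a : {rmorphism R -> S})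
    (e : {rmorphism R -> S'}) n (h : {mpoly R[n]}) :
  (forall c, a c = 0 -> e c = 0) -> map_mpoly a h = 0 -> map_mpoly e h = 0.
Proof.
move=> ae /mpolyP h0; apply/mpolyP => m; rewrite mcoeff_map_mpoly mcoeff0.
by apply: ae; rewrite -mcoeff_map_mpoly h0 mcoeff0.
Qed.

(** The data involve finitely many constants, which lift to a specializable ring. The lifted
    identities hold only modulo the kernel of [a], which [e] kills, so they hold over [K]; there [l]
    becomes 1, although [l - 1] was kept nonzero. *)
Lemma eigenvalue_eq1 (k : fieldType) n
    (f g : 'I_n -> {mpoly k[n]}) (l : k) r (u v : 'I_r -> {mpoly k[n]}) :
  [pchar k] =i pred0 ->
  (forall i, mmap (@mpolyC n k) f (g i) = 'X_i) ->
  (forall j, mmap (@mpolyC n k) f (u j) = l *: u j) ->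
  \sum_j v j * u j = 1 -> l = 1.
Proof.
move=> k0 fg fu vu; apply/eqP; apply: contraT => l1.
pose coefs m (w : 'I_m -> {mpoly k[n]}) :=
  flatten [seq [seq (w i)@_x | x <- msupp (w i)] | i <- enum 'I_m].
have coefsP m (w : 'I_m -> {mpoly k[n]}) i x : x \in msupp (w i) -> (w i)@_x \in coefs m w.
  move=> xw; apply/flattenP; exists [seq (w i)@_y | y <- msupp (w i)].
    by apply: map_f; rewrite mem_enum.
  exact: map_f.
have [R [a [specR lift]]] :=
  specializable_lift k0 (l :: coefs _ f ++ coefs _ g ++ coefs _ u ++ coefs _ v).
(* A chosen preimage under [a], with the default value 0 outside the image. *)
pose s (c : k) : R := if pselect (exists x, a x = c) is left H then projT1 (cid H) else 0.
have sK c : c \in l :: coefs _ f ++ coefs _ g ++ coefs _ u ++ coefs _ v -> a (s c) = c.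
  move=> /lift/asboolP H; rewrite /s; case: pselect => // H'.
  exact: (projT2 (cid H')).
pose L (h : {mpoly k[n]}) : {mpoly R[n]} := \sum_(x <- msupp h) s h@_x *: 'X_[x].
have LK m (w : 'I_m -> {mpoly k[n]}) i :
    {subset coefs m w <= l :: coefs _ f ++ coefs _ g ++ coefs _ u ++ coefs _ v} ->
    map_mpoly a (L (w i)) = w i.
  move=> wsub; rewrite [RHS]mpolyE raddf_sum big_seq [RHS]big_seq.
  apply: eq_bigr => x xw /=; rewrite map_mpolyZ map_mpolyX sK //.
  exact/wsub/coefsP.
have Lf i : map_mpoly a (L (f i)) = f i.
  by apply: LK => x; rewrite !(inE, mem_cat) => ->; rewrite orbT.
have Lg i : map_mpoly a (L (g i)) = g i.
  by apply: LK => x; rewrite !(inE, mem_cat) => ->; rewrite !orbT.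
have Lu i : map_mpoly a (L (u i)) = u i.
  by apply: LK => x; rewrite !(inE, mem_cat) => ->; rewrite !orbT.
have Lv i : map_mpoly a (L (v i)) = v i.
  by apply: LK => x; rewrite !(inE, mem_cat) => ->; rewrite !orbT.
have sl : a (s l) = l by apply: sK; rewrite mem_head.
have [|p [K [e [perK ke]]]] := specR a (s l - 1).
  by rewrite rmorphB rmorph1 sl subr_eq0.
suff -> : e (s l - 1) = 0 by rewrite eqxx.
rewrite rmorphB rmorph1; apply/eqP; rewrite subr_eq0; apply/eqP.
have push (h h' : {mpoly R[n]}) : map_mpoly a h = map_mpoly a h' -> map_mpoly e h = map_mpoly e h'.
  move=> hh'; apply/eqP; rewrite -subr_eq0 -rmorphB; apply/eqP.
  by apply: (map_mpoly_eq0 ke); rewrite rmorphB /= hh' subrr.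
have fE : (fun i => map_mpoly a (L (f i))) = f by apply/funext.
apply: (@eigenvalue_eq1_frobenius p K n (fun i => map_mpoly e (L (f i)))
  (fun i => map_mpoly e (L (g i))) _ r
  (fun i => map_mpoly e (L (u i))) (fun i => map_mpoly e (L (v i))) perK).
- move=> i; rewrite -map_mpoly_mmap -(map_mpolyX e); apply: push.
  by rewrite map_mpoly_mmap fE Lg fg map_mpolyX.
- move=> j; rewrite -map_mpoly_mmap -map_mpolyZ; apply: push.
  by rewrite map_mpoly_mmap fE map_mpolyZ Lu fu sl.
transitivity (map_mpoly e (\sum_j L (v j) * L (u j))).
  by rewrite raddf_sum; apply: eq_bigr => j _; rewrite /= rmorphM.
rewrite -[RHS](rmorph1 (map_mpoly e)); apply: push.
rewrite raddf_sum rmorph1 -[RHS]vu; apply: eq_bigr => j _.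
by rewrite /= rmorphM /= Lu Lv.
Qed.

End EigenvalueOne.

(** * Regular functions on the ind-group *)

Section RegularFunctions.
Variables (n : nat) (k : fieldType).
Local Notation P := {mpoly k[n]}.
Implicit Types (phi psi : polyaut n k) (p : nat).

Definition regular p (F : polyaut n k -> k) : Prop :=
  exists Q : {mpoly k[coord_dim n p]},
    forall phi, aut_deg p phi -> F phi = Q.@[@aut_coord n k p phi].

Lemma regular_ext p (F G : polyaut n k -> k) :
  (forall phi, aut_deg p phi -> F phi = G phi) -> regular p G -> regular p F.
Proof. by move=> FG [Q GQ]; exists Q => phi dphi; rewrite FG // GQ. Qed.

Lemma regular_const p c : regular p (fun=> c).
Proof. by exists c%:MP => phi _; rewrite mevalC. Qed.

Lemma regularD p F G : regular p F -> regular p G -> regular p (fun phi => F phi + G phi).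
Proof. by move=> [Q FQ] [Q' GQ]; exists (Q + Q') => phi d; rewrite FQ // GQ // mevalD. Qed.

Lemma regularM p F G : regular p F -> regular p G -> regular p (fun phi => F phi * G phi).
Proof. by move=> [Q FQ] [Q' GQ]; exists (Q * Q') => phi d; rewrite FQ // GQ // mevalM. Qed.

Lemma regular_sum p (I : Type) (r : seq I) (F : I -> polyaut n k -> k) :
  (forall i, regular p (F i)) -> regular p (fun phi => \sum_(i <- r) F i phi).
Proof.
move=> rF; elim: r => [|i r IH].
  by apply: regular_ext (regular_const p 0) => phi _; rewrite big_nil.
by apply: regular_ext (regularD (rF i) IH) => phi _; rewrite big_cons.
Qed.

Lemma regularX p F i : regular p F -> regular p (fun phi => F phi ^+ i).
Proof.
move=> rF; elim: i => [|i IH].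
  by apply: regular_ext (regular_const p 1) => phi _; rewrite expr0.
by apply: regular_ext (regularM rF IH) => phi _; rewrite exprS.
Qed.

Lemma regular_prod p (I : Type) (r : seq I) (F : I -> polyaut n k -> k) :
  (forall i, regular p (F i)) -> regular p (fun phi => \prod_(i <- r) F i phi).
Proof.
move=> rF; elim: r => [|i r IH].
  by apply: regular_ext (regular_const p 1) => phi _; rewrite big_nil.
by apply: regular_ext (regularM (rF i) IH) => phi _; rewrite big_cons.
Qed.

Lemma regular_meval p m (Q : {mpoly k[m]}) (F : 'I_m -> polyaut n k -> k) :
  (forall i, regular p (F i)) -> regular p (fun phi => Q.@[fun i => F i phi]).
Proof.
move=> rF; apply: regular_ext (fun phi _ => mevalE _ _) _.
apply: regular_sum => x; apply: regularM; first exact: regular_const.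
by apply: regular_prod => i; exact: regularX.
Qed.

(** The uniform degree bound makes this a morphism from [aut_deg p] to a finite-dimensional space of
    polynomials, so linear maps and evaluations preserve regularity. *)
Definition regular_poly p (G : polyaut n k -> P) : Prop :=
  (exists d, forall phi, aut_deg p phi -> (msize (G phi) <= d)%N) /\
  forall m, regular p (fun phi => (G phi)@_m).

Lemma regular_poly_ext p G H :
  (forall phi, aut_deg p phi -> G phi = H phi) -> regular_poly p H -> regular_poly p G.
Proof.
move=> GH [[d dH] rH]; split; first by exists d => phi dphi; rewrite GH // dH.
by move=> m; apply: regular_ext (rH m) => phi dphi; rewrite GH.
Qed.

Lemma regular_polyZ p F h : regular p F -> regular_poly p (fun phi => F phi *: h).
Proof.
move=> rF; split; first by exists (msize h) => phi _; exact: msizeZ_le.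
move=> m; apply: regular_ext (fun phi _ => mcoeffZ _ _ _) _.
by apply: regularM => //; exact: regular_const.
Qed.

Lemma regular_poly_const p h : regular_poly p (fun=> h).
Proof.
by apply: regular_poly_ext (regular_polyZ h (regular_const p 1)) => phi _; rewrite scale1r.
Qed.

Lemma regular_polyD p G H : regular_poly p G -> regular_poly p H ->
  regular_poly p (fun phi => G phi + H phi).
Proof.
move=> [[d dG] rG] [[e eH] rH]; split.
  exists (maxn d e) => phi dphi; apply: leq_trans (msizeD_le _ _) _.
  by rewrite geq_max !leq_max dG // eH // orbT.
by move=> m; apply: regular_ext (regularD (rG m) (rH m)) => phi _; rewrite mcoeffD.
Qed.

Lemma regular_poly_sum p (I : Type) (r : seq I) (G : I -> polyaut n k -> P) :
  (forall i, regular_poly p (G i)) -> regular_poly p (fun phi => \sum_(i <- r) G i phi).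
Proof.
move=> rG; elim: r => [|i r IH].
  by apply: regular_poly_ext (regular_poly_const p 0) => phi _; rewrite big_nil.
by apply: regular_poly_ext (regular_polyD (rG i) IH) => phi _; rewrite big_cons.
Qed.

Lemma regular_polyM p G H : regular_poly p G -> regular_poly p H ->
  regular_poly p (fun phi => G phi * H phi).
Proof.
move=> [[d dG] rG] [[e eH] rH]; split.
  exists (d + e).+1 => phi dphi; apply: leq_trans (msizeM_le _ _) _.
  by rewrite ltnS leq_add ?dG ?eH.
move=> m; apply: regular_ext (fun phi _ => mcoeffM _ _ _) _.
rewrite (_ : (fun phi => _) = fun phi =>
  \sum_(x <- [seq x : 'X_{1..n < (mdeg m).+1, (mdeg m).+1} <- index_enum _
      | m == (x.1 + x.2)%MM]) (G phi)@_x.1 * (H phi)@_x.2).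
  by apply: regular_sum => x; apply: regularM.
by apply/funext => phi; rewrite big_filter.
Qed.

Lemma regular_polyX p G i : regular_poly p G -> regular_poly p (fun phi => G phi ^+ i).
Proof.
move=> rG; elim: i => [|i IH].
  by apply: regular_poly_ext (regular_poly_const p 1) => phi _; rewrite expr0.
by apply: regular_poly_ext (regular_polyM rG IH) => phi _; rewrite exprS.
Qed.

Lemma regular_poly_prod p (I : Type) (r : seq I) (G : I -> polyaut n k -> P) :
  (forall i, regular_poly p (G i)) -> regular_poly p (fun phi => \prod_(i <- r) G i phi).
Proof.
move=> rG; elim: r => [|i r IH].
  by apply: regular_poly_ext (regular_poly_const p 1) => phi _; rewrite big_nil.
by apply: regular_poly_ext (regular_polyM (rG i) IH) => phi _; rewrite big_cons.
Qed.

Lemma regular_poly_linear p G (T : {linear P -> P}) :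
  regular_poly p G -> regular_poly p (fun phi => T (G phi)).
Proof.
move=> [[d dG] rG].
apply: (@regular_poly_ext _ _ (fun phi => \sum_(m : 'X_{1..n < d}) (G phi)@_m *: T 'X_[m])).
  move=> phi dphi; rewrite {1}(mpolywE (dG phi dphi)) raddf_sum.
  by apply: eq_bigr => m _ /=; rewrite linearZZ.
by apply: regular_poly_sum => m; apply: regular_polyZ.
Qed.

Lemma regular_poly_eval p G (b : 'I_n -> k) :
  regular_poly p G -> regular p (fun phi => (G phi).@[b]).
Proof.
move=> [[d dG] rG].
apply: (@regular_ext _ _ (fun phi => \sum_(m : 'X_{1..n < d}) (G phi)@_m * ('X_[m] : P).@[b])).
  move=> phi dphi; rewrite {1}(mpolywE (dG phi dphi)) raddf_sum.
  by apply: eq_bigr => m _; rewrite /= mevalZ.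
by apply: regular_sum => m; apply: regularM => //; exact: regular_const.
Qed.

Lemma polyaut_mmap phi (f : P) :
  phi f = mmap (@mpolyC n k) (fun i => phi 'X_i) f.
Proof.
rewrite [in LHS](mpolyE f) raddf_sum; apply: eq_bigr => m _ /=.
rewrite linearZZ mul_mpolyC; congr (_ *: _).
by rewrite mpolyXE_id rmorph_prod /mmap1; apply: eq_bigr => i _; rewrite rmorphXn.
Qed.

Lemma regular_poly_app p f : regular_poly p (fun phi => phi f).
Proof.
have rX i : regular_poly p (fun phi => phi 'X_i).
  split=> [|m]; first by exists p.+1 => phi; apply.
  have [mp|pm] := ltnP (mdeg m) p.+1; last first.
    apply: regular_ext (regular_const p 0) => phi dphi.
    by apply/memN_msupp_eq0/msize_mdeg_ge/(leq_trans _ pm).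
  exists 'X_(enum_rank (i, BMultinom mp)) => phi dphi.
  by rewrite mevalXU /aut_coord enum_rankK.
apply: regular_poly_ext (fun phi _ => polyaut_mmap phi f) _.
apply: regular_poly_sum => m; apply: regular_polyM; first exact: regular_poly_const.
by apply: regular_poly_prod => i; apply: regular_polyX.
Qed.

Lemma closed_zeros (I : Type) (F : I -> polyaut n k -> k) :
  (forall i p, regular p (F i)) -> closed [set phi | forall i, F i phi = 0].
Proof.
move=> rF; apply/closed_ind_closed => p.
pose Q i := projT1 (cid (rF i p)).
have QE i : forall phi, aut_deg p phi -> F i phi = (Q i).@[@aut_coord n k p phi].
  exact: projT2 (cid (rF i p)).
exists [set R | exists i, R = Q i]; apply/seteqP; split=> phi /=.
  by move=> [F0 dphi]; split=> // _ [i ->]; rewrite -QE // F0.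
by move=> [dphi F0]; split=> // i; rewrite (QE _ _ dphi); apply: F0; exists i.
Qed.

Lemma closed_bounded_zeros (A : set (polyaut n k)) p : closed A ->
  exists S : set {mpoly k[coord_dim n p]}, forall phi, aut_deg p phi ->
    A phi <-> forall Q, S Q -> Q.@[@aut_coord n k p phi] = 0.
Proof.
move=> /closed_ind_closed/(_ p)[S AS]; exists S => phi dphi.
rewrite (propext (_ : A phi <-> (A `&` @aut_deg n k p) phi)); last by split=> [?|[]].
by rewrite AS; split=> [[]|].
Qed.

(** Closedness is tested degree by degree, so the closed set [B] may change with [p]. *)
Lemma closed_from_bounded (A : set (polyaut n k)) :
  (forall p, exists B, closed B /\ forall phi, aut_deg p phi -> A phi <-> B phi) -> closed A.
Proof.
move=> AB; apply/closed_ind_closed => p; have [B [/closed_ind_closed/(_ p) [S BS] AB']] := AB p.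
exists S; rewrite -BS; apply/seteqP; split=> phi [] Aphi dphi; split=> //; exact/AB'.
Qed.

Lemma aut_deg_uniform p (G : polyaut n k -> polyaut n k) :
  (forall i, regular_poly p (fun phi => G phi 'X_i)) ->
  exists q, forall phi, aut_deg p phi -> aut_deg q (G phi).
Proof.
move=> rG; pose d i := projT1 (cid (rG i).1).
have dP i : forall phi, aut_deg p phi -> (msize (G phi 'X_i) <= d i)%N.
  exact: projT2 (cid (rG i).1).
exists (\max_i d i) => phi dphi i; apply: leq_trans (dP i phi dphi) (leqW _).
exact: (leq_bigmax i).
Qed.

Lemma regular_poly_translate p x y f : regular_poly p (fun phi => (x * phi * y)%g f).
Proof. by exact: (regular_poly_linear x (regular_poly_app p (y f))). Qed.

Lemma aut_deg_translate p x y :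
  exists q, forall phi, aut_deg p phi -> aut_deg q (x * phi * y)%g.
Proof. by apply: aut_deg_uniform => i; exact: regular_poly_translate. Qed.

(** A translation maps [aut_deg p] into some [aut_deg q] with coordinates that are regular in [phi],
    so equations pull back; [R Q] is the pullback of [Q]. *)
Lemma closed_translate (A : set (polyaut n k)) (x y : polyaut n k) :
  closed A -> closed [set phi | A (x * phi * y)%g].
Proof.
move=> cA; apply/closed_ind_closed => p.
have [q dq] := aut_deg_translate p x y.
have [S AS] := closed_bounded_zeros q cA.
have rc (j : 'I_(coord_dim n q)) : regular p (fun phi => @aut_coord n k q (x * phi * y)%g j).
  exact: (regular_poly_translate p x y _).2.
pose R (Q : {mpoly k[coord_dim n q]}) := projT1 (cid (regular_meval Q rc)).
have RE Q : forall phi, aut_deg p phi -> Q.@[@aut_coord n k q (x * phi * y)%g] =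
    (R Q).@[@aut_coord n k p phi] := projT2 (cid (regular_meval Q rc)).
exists [set R Q | Q in S]; apply/seteqP; split=> phi /=.
  move=> [Aphi dphi]; split=> // _ [Q SQ <-]; rewrite -RE //.
  by have /AS := dq _ dphi; move=> [+ _]; apply.
move=> [dphi S0]; split=> //; apply/(AS _ (dq _ dphi)) => Q SQ.
by rewrite RE //; apply: S0; exists Q.
Qed.

Lemma closed_aut_deg p : closed (@aut_deg n k p).
Proof.
rewrite (_ : @aut_deg n k p = [set phi | forall im : 'I_n * {m : 'X_{1..n} | (p < mdeg m)%N},
    (phi 'X_im.1)@_(val im.2) = 0]).
  by apply: closed_zeros => im q; exact: (regular_poly_app q _).2.
apply/seteqP; split=> phi /=.
  by move=> dphi [i [m pm]] /=; apply/memN_msupp_eq0/msize_mdeg_ge/(leq_trans (dphi i)).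
move=> c0 i; rewrite msizeE; apply/bigmax_leqP_seq => m mphi _.
rewrite ltnS leqNgt; apply/negP => pm.
by have := c0 (i, exist _ m pm); apply/eqP; rewrite -mcoeff_msupp.
Qed.

(** By linearity and the Leibniz rule, commutation with [D] need only be tested on the variables,
    where it is a system of regular equations. *)
Lemma closed_AutD (D : {linear P -> P}) : is_derivation D -> closed (AutD D).
Proof.
move=> derD.
rewrite (_ : AutD D = [set phi | forall im : 'I_n * 'X_{1..n},
    (phi (D 'X_im.1) - D (phi 'X_im.1))@_im.2 = 0]).
  apply: closed_zeros => -[i m] p.
  apply: regular_ext (fun phi _ => mcoeffB _ _ _) _; apply: regularD.
    exact: (regular_poly_app p _).2.
  apply: regular_ext (fun phi _ => esym (mulN1r _)) _.
  apply: regularM; first exact: regular_const.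
  exact: (regular_poly_linear D (regular_poly_app p _)).2.
have D1 : D 1 = 0.
  by have /eqP := derD 1 1; rewrite !mulr1 mul1r -subr_eq0 opprD addNKr oppr_eq0 => /eqP.
apply/seteqP; split=> phi /= H.
  by move=> im; rewrite H subrr mcoeff0.
have HX i : phi (D 'X_i) = D (phi 'X_i).
  apply/eqP; rewrite -subr_eq0; apply/eqP/mpolyP => m; rewrite mcoeff0.
  exact: (H (i, m)).
have HM f g : phi (D f) = D (phi f) -> phi (D g) = D (phi g) ->
    phi (D (f * g)) = D (phi (f * g)).
  by move=> Hf Hg; rewrite derD rmorphM derD rmorphD !rmorphM /= Hf Hg.
move=> f; rewrite (mpolyE f) !raddf_sum; apply: eq_bigr => m _ /=.
rewrite !linearZZ; congr (_ *: _); rewrite mpolyXE_id.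
elim/big_rec: _ => [|i g _ IH]; first by rewrite rmorph1 D1 rmorph0.
apply: (HM _ _ _ IH); elim: (m i) => [|j IHj]; first by rewrite expr0 rmorph1 D1 rmorph0.
by rewrite exprS; exact: HM.
Qed.

End RegularFunctions.

(** * The orbit of the origin *)

Section OrbitMap.

(** A prefix of maximal rank already has every [v j] in its row space. It serves to determine a
    polynomial of bounded degree by finitely many derivatives at the origin. *)
Lemma row_full_prefix (k : fieldType) N (v : nat -> 'rV[k]_N) :
  (forall w : 'cV_N, (forall j, v j *m w = 0) -> w = 0) ->
  exists J, row_full (\matrix_(j < J) v j).
Proof.
move=> sep; pose A J := \matrix_(j < J) v j.
pose good r := `[<exists J, \rank (A J) = r>].
have ex_good : exists r, good r by exists (\rank (A 0%N)); apply/asboolP; exists 0%N.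
have bound r : good r -> (r <= N)%N by move=> /asboolP[J <-]; exact: rank_leq_col.
case: (ex_maxnP ex_good bound) => _ /asboolP[J <-] maxJ; exists J.
have vA j : (v j <= A J)%MS.
  have AA J1 J2 : (J1 <= J2)%N -> (A J1 <= A J2)%MS.
    move=> le12; apply/row_subP => i; rewrite rowK.
    rewrite (_ : v i = row (widen_ord le12 i) (A J2)) ?row_sub //.
    by rewrite rowK.
  apply: (@submx_trans _ _ _ _ _ _ (A (maxn J j.+1))).
    rewrite (_ : v j = row (Ordinal (leq_maxr J j.+1)) (A (maxn J j.+1))) ?row_sub //.
    by rewrite rowK.
  have leJ := AA _ _ (leq_maxl J j.+1).
  rewrite -(mxrank_leqif_sup leJ) eqn_leq mxrankS //=.
  by apply: maxJ; apply/asboolP; exists (maxn J j.+1).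
rewrite -sub1mx submxE mul1mx; apply/eqP/matrixP => a b.
suff /matrixP/(_ a 0) : col b (cokermx (A J)) = 0 by rewrite !mxE.
apply: sep => j; rewrite colE mulmxA; have := vA j; rewrite submxE => /eqP ->.
exact: mul0mx.
Qed.

Variables (k : fieldType) (n : nat).
Local Notation P := {mpoly k[n]}.
Variable D : {linear P -> P}.
Hypotheses (derD : is_derivation D) (simpleD : is_simple D).

Definition orbit0 (phi : polyaut n k) (i : 'I_n) : k := (phi 'X_i).@[fun=> 0].

Lemma meval_orbit0 (phi : polyaut n k) (f : P) : (phi f).@[fun=> 0] = f.@[orbit0 phi].
Proof.
rewrite polyaut_mmap /mmap raddf_sum mevalE; apply: eq_bigr => m _ /=.
rewrite mevalM mevalC; congr (_ * _); rewrite /mmap1 rmorph_prod.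
by apply: eq_bigr => i _; rewrite rmorphXn.
Qed.

Lemma jet_eq0 (f : P) : (forall j, (iter j D f).@[fun=> 0] = 0) -> f = 0.
Proof.
pose I : set P := [set g | forall j, (iter j D g).@[fun=> 0] = 0].
have iterD j g h : iter j D (g + h) = iter j D g + iter j D h.
  by elim: j => //= j ->; rewrite raddfD.
have idI : is_ideal I.
  split=> [j|g h Ig Ih j|a u Iu j].
  - by elim: j => [|j IH]; [rewrite /= meval0 | rewrite iterSr raddf0].
  - by rewrite iterD mevalD Ig Ih addr0.
  elim: j a u Iu => [|j IH] a u Iu.
    by rewrite /= mevalM (Iu 0%N) mulr0.
  rewrite iterSr derD iterD mevalD !IH ?addr0 // => i.
  by rewrite -iterSr Iu.
have [|I0|IT] := simpleD idI.
- by move=> _ [g Ig <-] j; rewrite -iterSr Ig.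
- by move=> If; have : I f by []; rewrite I0.
have : I 1 by rewrite IT.
by move=> /(_ 0%N) /= /eqP; rewrite meval1 oner_eq0.
Qed.

(** The derivatives of [phi 'X_i] at the origin are the values of [iter j D 'X_i] at [orbit0 phi].
    By [jet_eq0], finitely many of them determine a polynomial of degree at most [p]; the left
    inverse [L] of the resulting matrix recovers its coefficients and does not depend on [phi]. *)
Lemma coef_orbit0 p : exists C : 'I_n -> 'X_{1..n} -> P,
  forall phi, AutD D phi -> aut_deg p phi ->
  forall i m, (phi 'X_i)@_m = (C i m).@[orbit0 phi].
Proof.
pose B := {: 'X_{1..n < p.+1}}.
pose bm (b : 'I_#|B|) : B := enum_val b.
pose v j : 'rV[k]_#|B| := \row_b (iter j D 'X_[bm b]).@[fun=> 0].
have vE j (w : 'I_#|B| -> k) :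
    \sum_b v j 0 b * w b = (iter j D (\sum_b w b *: 'X_[bm b])).@[fun=> 0].
  have -> : iter j D (\sum_b w b *: 'X_[bm b]) =
      \sum_b w b *: iter j D 'X_[bm b].
    elim: j => //= j ->; rewrite raddf_sum; apply: eq_bigr => b _ /=.
    by rewrite linearZZ.
  rewrite raddf_sum; apply: eq_bigr => b _ /=.
  by rewrite mevalZ mxE mulrC.
have [|J /row_fullP[L LA]] := @row_full_prefix k _ v.
  move=> w vw; have f0 : \sum_b w b 0 *: 'X_[bm b] = 0 :> P.
    apply: jet_eq0 => j; rewrite -vE.
    by have /matrixP/(_ 0 0) := vw j; rewrite !mxE.
  apply/colP => b; rewrite mxE; have /mpolyP/(_ (bm b)) := f0.
  rewrite raddf_sum mcoeff0 (bigD1 b) //= big1 => [|c cb].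
    by rewrite mcoeffZ mcoeffX eqxx mulr1 addr0.
  by rewrite mcoeffZ mcoeffX -bmeqP (inj_eq enum_val_inj) (negPf cb) mulr0.
exists (fun i m => if insub m is Some b then
    \sum_(j < J) L (enum_rank (b : B)) j *: iter j D 'X_i else 0).
move=> phi phiD dphi i m.
case: insubP => [b _ <-|]; last first.
  rewrite -leqNgt meval0 => pm.
  exact/memN_msupp_eq0/msize_mdeg_ge/(leq_trans (dphi i)).
pose w (b : 'I_#|B|) := (phi 'X_i)@_(bm b).
have phiE : phi 'X_i = \sum_b w b *: 'X_[bm b].
  rewrite {1}(mpolywE (dphi i)) (reindex bm) //=.
  by apply: onW_bij; exact: enum_val_bij.
have phi_iter j f : phi (iter j D f) = iter j D (phi f).
  by elim: j => //= j <-; rewrite phiD.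
have Aw : (\matrix_(j < J) v j) *m (\col_b w b) =
    \col_(j < J) (iter j D 'X_i).@[orbit0 phi].
  apply/colP => j; rewrite !mxE -meval_orbit0 phi_iter phiE -vE.
  by apply: eq_bigr => b' _; rewrite !mxE.
have : \col_b w b = L *m \col_(j < J) (iter j D 'X_i).@[orbit0 phi].
  by rewrite -Aw mulmxA LA mul1mx.
move=> /colP/(_ (enum_rank (b : B))); rewrite !mxE /w /bm enum_rankK => ->.
rewrite raddf_sum; apply: eq_bigr => j _.
by rewrite /= mevalZ mxE.
Qed.

End OrbitMap.

(** * Irreducible sets and the identity component *)

Section IrreducibleSubsets.
Variables (k : fieldType) (n : nat).
Local Notation P := {mpoly k[n]}.
Local Notation aut := (polyaut n k).

Definition irreducible_set (X : set aut) : Prop :=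
  forall A B : set aut, closed A -> closed B -> X `<=` A `|` B -> X `<=` A \/ X `<=` B.

Definition setMg (X Y : set aut) : set aut :=
  [set z | exists x y, [/\ X x, Y y & z = (x * y)%g]].

Lemma irreducible_set1 (x : aut) : irreducible_set [set x].
Proof. by move=> A B _ _ /(_ x erefl)[] ?; [left | right] => _ ->. Qed.

(** Each [xY] is irreducible, hence inside [A] or inside [B]. The [x] with [xY] inside [A] form a
    closed set, likewise for [B], and irreducibility of [X] concludes. *)
Lemma irreducible_setMg (X Y : set aut) :
  irreducible_set X -> irreducible_set Y -> irreducible_set (setMg X Y).
Proof.
move=> irrX irrY A B cA cB XYAB.
have cT (C : set aut) : closed C -> closed [set x | forall y, Y y -> C (x * y)%g].
  move=> cC; rewrite (_ : mkset _ = \bigcap_(y in Y) [set x | C (1 * x * y)%g]).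
    by apply: closed_bigI => y _; exact: closed_translate.
  by apply/seteqP; split=> x xC y /xC /=; rewrite mul1g.
have cL x (C : set aut) : closed C -> closed [set y | C (x * y)%g].
  move=> cC; rewrite (_ : mkset _ = [set y | C (x * y * 1)%g]).
    exact: closed_translate.
  by apply/seteqP; split=> y /=; rewrite mulg1.
have [x Xx|H|H] := irrX _ _ (cT A cA) (cT B cB).
- have [y Yy|H|H] := irrY _ _ (cL x A cA) (cL x B cB); [|by left..|by right].
  by apply: XYAB; exists x, y.
- by left=> _ [x [y [Xx Yy ->]]]; exact: H.
- by right=> _ [x [y [Xx Yy ->]]]; exact: H.
Qed.

Lemma aut_deg_setMg p q : exists r, setMg (@aut_deg n k p) (@aut_deg n k q) `<=` @aut_deg n k r.
Proof.
pose d (m : 'X_{1..n < q.+1}) := projT1 (cid (regular_poly_app p ('X_[m] : P)).1).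
have dP (m : 'X_{1..n < q.+1}) : forall x : aut, aut_deg p x -> (msize (x 'X_[m]) <= d m)%N.
  exact: projT2 (cid (regular_poly_app p ('X_[m] : P)).1).
exists (\max_m d m) => _ [x [y [dx dy ->]]] i; apply: leqW.
change ((x * y)%g 'X_i) with (x (y 'X_i)).
rewrite (mpolywE (dy i)) raddf_sum; apply: leq_trans (msize_sum _ _ _) _.
apply/bigmax_leqP => m _ /=; rewrite linearZZ.
apply: leq_trans (msizeZ_le _ _) (leq_trans (dP m x dx) _).
exact: (leq_bigmax m).
Qed.

(** The ideals of polynomials vanishing on the [A j] ascend, and a closed set of bounded degree is
    recovered from its ideal. *)
Lemma descending_closed_stabilize p (A : nat -> set aut) :
  (forall j, closed (A j)) -> (forall j, A j `<=` @aut_deg n k p) ->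
  (forall j, A j.+1 `<=` A j) -> exists j, A j `<=` A j.+1.
Proof.
move=> cA dA decA.
pose I j : set {mpoly k[coord_dim n p]} :=
  [set Q | forall phi, A j phi -> Q.@[@aut_coord n k p phi] = 0].
have [j|j Q IQ phi /decA/IQ //|j Ij] := @ascending_ideals_stabilize _ _ I.
  split=> [phi _|Q R IQ IR phi Aphi|Q R IR phi Aphi]; first by rewrite meval0.
    by rewrite mevalD IQ // IR // addr0.
  by rewrite mevalM IR // mulr0.
exists j => phi Aphi; have [S AS] := closed_bounded_zeros p (cA j.+1).
apply/(AS _ (dA _ _ Aphi)) => Q SQ; apply: Ij Aphi => psi Apsi.
exact: (AS _ (dA _ _ Apsi)).1.
Qed.

Lemma noetherian_ind p (T : set aut -> Prop) :
  (forall A, closed A -> A `<=` @aut_deg n k p ->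
    (forall B, closed B -> B `<=` A -> ~ A `<=` B -> T B) -> T A) ->
  forall A, closed A -> A `<=` @aut_deg n k p -> T A.
Proof.
move=> ind A cA dA; apply: contrapT => nTA.
pose bad (B : set aut) := [/\ closed B, B `<=` @aut_deg n k p & ~ T B].
(* A counterexample contains a strictly smaller one; iterating the choice gives a forbidden
   descending chain. *)
have next (B : {B | bad B}) : exists C : {B | bad B},
    sval C `<=` sval B /\ ~ sval B `<=` sval C.
  case: B => B [cB dB nTB] /=; apply: contrapT => nC; apply: nTB; apply: ind => // C cC CB nBC.
  apply: contrapT => nTC; apply: nC.
  by exists (exist _ C (And3 cC (subset_trans CB dB) nTC)).
pose f B := projT1 (cid (next B)).
have fP B : sval (f B) `<=` sval B /\ ~ sval B `<=` sval (f B) := projT2 (cid (next B)).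
pose s j := iter j f (exist _ A (And3 cA dA nTA)).
have [j|j|j|j] := @descending_closed_stabilize p (fun j => sval (s j)).
- by case: (s j) => B [].
- by case: (s j) => B [].
- exact: (fP (s j)).1.
- exact: (fP (s j)).2.
Qed.

Variable D : {linear P -> P}.
Hypotheses (derD : is_derivation D) (simpleD : is_simple D).

(** The building blocks of the identity component, stable under products without taking closures. *)
Definition identity_piece (X : set aut) : Prop :=
  [/\ X 1%g, X `<=` AutD D, exists p, X `<=` @aut_deg n k p & irreducible_set X].

Lemma AutD1 : AutD D 1%g. Proof. by []. Qed.

Lemma AutDM x y : AutD D x -> AutD D y -> AutD D (x * y)%g.
Proof. by move=> xD yD f; rewrite /= yD xD. Qed.

Lemma AutDV x : AutD D x -> AutD D x^-1%g.
Proof.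
move=> xD f; apply: (bij_inj (polyaut_bij x)).
by rewrite xD !(polyautVK x).
Qed.

Lemma identity_piece1 : identity_piece [set 1%g].
Proof.
split=> //; [by move=> _ ->; exact: AutD1 | | exact: irreducible_set1].
by exists 1%N => _ -> i; rewrite msizeX mdeg1.
Qed.

Lemma identity_pieceM X Y :
  identity_piece X -> identity_piece Y -> identity_piece (setMg X Y).
Proof.
move=> [X1 XD [p Xp] irrX] [Y1 YD [q Yq] irrY]; split.
- by exists 1%g, 1%g; rewrite mulg1.
- by move=> _ [x [y [/XD xD /YD yD ->]]]; exact: AutDM.
- have [r dr] := aut_deg_setMg p q; exists r => _ [x [y [/Xp xp /Yq yq ->]]].
  by apply: dr; exists x, y.
- exact: irreducible_setMg.
Qed.

Definition orbit_ideal (X : set aut) : set P :=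
  [set Q | forall x, X x -> Q.@[orbit0 x] = 0].

Lemma orbit_ideal_prime X : identity_piece X -> is_prime_ideal (orbit_ideal X).
Proof.
move=> [X1 _ _ irrX]; split.
- split=> [x _|Q R IQ IR x Xx|Q R IR x Xx]; first by rewrite meval0.
    by rewrite mevalD IQ // IR // addr0.
  by rewrite mevalM IR // mulr0.
- by move=> /(_ _ X1) /eqP; rewrite meval1 oner_eq0.
have cQ (Q : P) : closed [set x : aut | Q.@[orbit0 x] = 0].
  rewrite (_ : mkset _ = [set x | forall _ : unit, Q.@[orbit0 x] = 0]).
    apply: closed_zeros => _ p; apply: regular_meval => i.
    exact/regular_poly_eval/regular_poly_app.
  by apply/seteqP; split=> x /=; [move=> -> | apply].
move=> Q R IQR; apply: (irrX _ _ (cQ Q) (cQ R)) => x /IQR /eqP.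
by rewrite mevalM mulf_eq0 => /orP[] /eqP; [left | right].
Qed.

(** By [independent_mod_extend], each strict descent of the prime ideal yields one more independent
    element, and [independent_mod_size] allows at most [n]. *)
Lemma minimal_orbit_ideal : exists X, identity_piece X /\
  forall Y, identity_piece Y -> orbit_ideal Y `<=` orbit_ideal X ->
    orbit_ideal X `<=` orbit_ideal Y.
Proof.
apply: contrapT => nomin.
suff /(_ n.+1)[X pX [g indg]] : forall r, exists2 X, identity_piece X &
    exists g : 'I_r -> P, independent_mod (orbit_ideal X) g.
  have [idX _ _] := orbit_ideal_prime pX.
  by have := independent_mod_size idX indg; rewrite ltnn.
elim=> [|r [X pX [g indg]]].
  exists [set 1%g]; first exact: identity_piece1.
  exists (fun=> 0) => Q /(_ _ erefl); rewrite (nvar0_mpolyC Q) mmapC mevalC => ->.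
  by rewrite mpolyC0.
have [Y [pY YX [f Xf nYf]]] : exists Y, [/\ identity_piece Y,
    orbit_ideal Y `<=` orbit_ideal X & exists2 f, orbit_ideal X f & ~ orbit_ideal Y f].
  apply: contrapT => noY; apply: nomin; exists X; split=> // Y pY YX f Xf.
  by apply: contrapT => nYf; apply: noY; exists Y; split=> //; exists f.
exists Y => //; have [idX _ _] := orbit_ideal_prime pX.
exact: (independent_mod_extend idX (orbit_ideal_prime pY) YX indg Xf nYf).
Qed.

Lemma identity_piece_bounded : exists q, forall X, identity_piece X -> X `<=` @aut_deg n k q.
Proof.
have [X [pX minX]] := minimal_orbit_ideal.
have [X1 XD [q Xq] _] := pX; exists q => Y pY y Yy i.
have pXY := identity_pieceM pX pY.
have [_ XYD [r XYr] _] := pXY.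
have [Y1 _ _ _] := pY.
have XXY : X `<=` setMg X Y by move=> x Xx; exists x, 1%g; rewrite mulg1.
have YXY : setMg X Y y by exists 1%g, y; rewrite mul1g.
have sub : orbit_ideal X `<=` orbit_ideal (setMg X Y).
  by apply: minX => // f If x /XXY; exact: If.
(* The bound [r] of the product set covers both [X] and [y], so the same polynomials [C i m] compute
   the coefficients of both. *)
have [C CE] := coef_orbit0 derD simpleD r.
rewrite msizeE; apply/bigmax_leqP_seq => m; rewrite mcoeff_msupp => ym _.
rewrite ltnS leqNgt; apply: contra ym => qm.
rewrite (CE _ (XYD _ YXY) (XYr _ YXY)); apply/eqP.
apply: sub YXY => x Xx; rewrite -(CE _ (XD _ Xx) (XYr _ (XXY _ Xx))).
exact/memN_msupp_eq0/msize_mdeg_ge/(leq_trans (Xq _ Xx i)).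
Qed.

Definition AutD0 : set aut := [set x | exists2 X, identity_piece X & X x].

Lemma AutD0M x y : AutD0 x -> AutD0 y -> AutD0 (x * y)%g.
Proof.
move=> [X pX Xx] [Y pY Yy]; exists (setMg X Y); first exact: identity_pieceM.
by exists x, y.
Qed.

Lemma AutD0_sub : AutD0 `<=` AutD D.
Proof. by move=> x [X [_ XD _ _]]; exact: XD. Qed.

Lemma AutD0_bounded : exists q, AutD0 `<=` @aut_deg n k q.
Proof.
by have [q Xq] := identity_piece_bounded; exists q => x [X pX]; exact: Xq.
Qed.

(** Noetherian induction on [A]: an irreducible [A] lies in [AutD0] or misses it, and a reducible
    one is cut into two smaller closed sets. *)
Lemma AutD0_clopen_bounded p (A : set aut) :
  closed A -> A `<=` @aut_deg n k p -> A `<=` AutD D ->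
  closed (A `&` AutD0) /\ closed (A `\` AutD0).
Proof.
move=> cA dA AD.
pose T B := B `<=` AutD D -> closed (B `&` AutD0) /\ closed (B `\` AutD0).
apply: (@noetherian_ind p T) => // {cA dA AD}A cA dA IH AD.
have [irrA|] := pselect (irreducible_set A).
  have [[h [Ah [X pX Xh]]]|AG0] := pselect (exists h, A h /\ AutD0 h).
    have AG : A `<=` AutD0.
      (* The translate of [A] by the inverse of [h] contains 1, so it is a piece, and [a] is the
         product of [h] with one of its elements. *)
      move=> a Aa; rewrite -(mulKVg h a); apply: AutD0M; first by exists X.
      exists (setMg [set h^-1%g] A); last by exists h^-1%g, a.
      split.
      - by exists h^-1%g, h; rewrite mulVg.
      - by move=> _ [_ [b [-> /AD bD ->]]]; apply: AutDM => //; apply/AutDV/AD.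
      - have [q dq] := aut_deg_translate p h^-1%g 1%g.
        by exists q => _ [_ [b [-> /dA/dq + ->]]]; rewrite mulg1.
      - exact/irreducible_setMg/irrA/irreducible_set1.
    have -> : A `\` AutD0 = set0 by apply/seteqP; split=> // x [/AG].
    by rewrite setIidl //; split=> //; exact: closed0.
  rewrite (_ : A `&` _ = set0); last first.
    by apply/seteqP; split=> // x [Ax Gx]; apply: AG0; exists x.
  rewrite (_ : A `\` _ = A); first by split=> //; exact: closed0.
  apply/seteqP; split=> [x []//|x Ax]; split=> // Gx.
  by apply: AG0; exists x.
move=> /existsNP[B /existsNP[C /not_implyP[cB /not_implyP[cC /not_implyP[ABC]]]]].
move=> /not_orP[nAB nAC].
have AE : A = (A `&` B) `|` (A `&` C) by rewrite -setIUr setIidl.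
have TB E : closed E -> ~ A `<=` E -> T (A `&` E).
  move=> cE nAE; apply: IH; [exact: closedI | exact: subIsetl |].
  by move=> /subset_trans/(_ (@subIsetr _ _ _)).
have [] := TB _ cB nAB; first by apply: subset_trans AD; exact: subIsetl.
have [] := TB _ cC nAC; first by apply: subset_trans AD; exact: subIsetl.
move=> C1 C2 B1 B2.
by rewrite AE setIUl setDUl; split; apply: closedU.
Qed.

Lemma AutD0_clopen : closed AutD0 /\ closed (AutD D `\` AutD0).
Proof.
have H p := @AutD0_clopen_bounded p _ (closedI (closed_AutD derD) (@closed_aut_deg n k p))
  (@subIsetr _ _ _) (@subIsetl _ _ _).
split; apply: closed_from_bounded => p; have [H1 H2] := H p.
  exists (AutD D `&` @aut_deg n k p `&` AutD0); split=> // x dx.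
  by split=> [Gx|[]//]; split=> //; split=> //; exact: AutD0_sub.
exists ((AutD D `&` @aut_deg n k p) `\` AutD0); split=> // x dx.
by split=> [[xD nG]|[[]]//].
Qed.

Lemma connected_AutD_bounded : connected (AutD D) -> exists q, AutD D `<=` @aut_deg n k q.
Proof.
move=> conn; have [c1 c2] := AutD0_clopen.
have [q Gq] := AutD0_bounded; exists q.
suff <- : AutD0 = AutD D by [].
apply: conn.
- by exists 1%g; exists [set 1%g] => //; exact: identity_piece1.
- exists (~` (AutD D `\` AutD0)); first by rewrite openC.
  rewrite setCD setIUr setICr set0U.
  by apply/seteqP; split=> [x Gx|x []//]; split=> //; exact: AutD0_sub.
- exists AutD0 => //; apply/seteqP; split=> [x Gx|x []//]; split=> //.
  exact: AutD0_sub.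
Qed.

End IrreducibleSubsets.

(** * Locally finite and unipotent operators *)

Section OperatorPolynomials.
Variables (k : fieldType) (V : lmodType k) (phi : {linear V -> V}).

Definition operator_horner (p : {poly k}) (v : V) : V :=
  \sum_(i < size p) p`_i *: iter i phi v.

Lemma operator_hornerE N (p : {poly k}) v : (size p <= N)%N ->
  operator_horner p v = \sum_(i < N) p`_i *: iter i phi v.
Proof.
move=> pN; rewrite /operator_horner (big_ord_widen N (fun i => p`_i *: iter i phi v)) //.
rewrite big_mkcond; apply: eq_bigr => i _; case: ltnP => // /leq_sizeP/(_ i (leqnn i)) ->.
by rewrite scale0r.
Qed.

Lemma operator_hornerD p q v :
  operator_horner (p + q) v = operator_horner p v + operator_horner q v.
Proof.
pose N := maxn (size p) (size q).
rewrite (@operator_hornerE N) ?size_polyD // (@operator_hornerE N p) ?leq_maxl //.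
rewrite (@operator_hornerE N q) ?leq_maxr // -big_split; apply: eq_bigr => i _.
by rewrite coefD scalerDl.
Qed.

Lemma operator_hornerZ c p v : operator_horner (c *: p) v = c *: operator_horner p v.
Proof.
rewrite (@operator_hornerE (size p)) ?size_scale_leq // scaler_sumr.
by apply: eq_bigr => i _; rewrite coefZ scalerA.
Qed.

Lemma operator_hornerXM p v : operator_horner ('X * p) v = phi (operator_horner p v).
Proof.
rewrite (@operator_hornerE (size p).+1); last first.
  by rewrite mulrC (leq_trans (size_polyMleq _ _)) // size_polyX addn2.
rewrite big_ord_recl coefXM scale0r add0r raddf_sum; apply: eq_bigr => i _ /=.
by rewrite coefXM linearZZ.
Qed.

Lemma operator_hornerXsubC c p v :
  operator_horner (('X - c%:P) * p) v = phi (operator_horner p v) - c *: operator_horner p v.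
Proof.
rewrite mulrBl operator_hornerD operator_hornerXM; congr (_ + _).
by rewrite mul_polyC -scaleNr operator_hornerZ scaleNr.
Qed.

Lemma linear_relation_in_span m (b : 'I_m -> V) (u : nat -> V) :
  (forall i, exists c : 'I_m -> k, u i = \sum_j c j *: b j) ->
  exists2 p : {poly k}, p != 0 & \sum_(i < size p) p`_i *: u i = 0.
Proof.
move=> ub; pose c i := projT1 (cid (ub i)).
have cE i : u i = \sum_j c i j *: b j := projT2 (cid (ub i)).
have [w w0 wc] := left_kernel_nontrivial (\matrix_(i < m.+1, j < m) c i j) (ltnSn m).
pose p := rVpoly w; have sp : (size p <= m.+1)%N by exact: size_poly.
exists p; first by apply: contra w0 => /eqP p0; rewrite -[w]rVpolyK -/p p0 linear0.
have -> : \sum_(i < size p) p`_i *: u i = \sum_(i < m.+1) p`_i *: u i.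
  rewrite (big_ord_widen m.+1 (fun i => p`_i *: u i)) // big_mkcond.
  apply: eq_bigr => i _; case: ltnP => // /leq_sizeP/(_ i (leqnn i)) ->.
  by rewrite scale0r.
under eq_bigr => i _ do rewrite cE scaler_sumr.
rewrite exchange_big big1 // => j _ /=.
under eq_bigr => i _ do rewrite scalerA.
rewrite -scaler_suml (_ : \sum_i _ = 0) ?scale0r //.
have /rowP/(_ j) := wc; rewrite !mxE => wj; rewrite -[RHS]wj; apply: eq_bigr => i _.
by rewrite coef_rVpoly_ord mxE.
Qed.

(** An annihilating polynomial of degree [s] expresses the [s]-th iterate of [v] through the earlier
    ones, so these span a stable subspace. Conversely, the iterates of [v] stay in a
    finite-dimensional space and are linearly dependent. *)
Lemma locally_finiteP : locally_finite phi <->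
  forall v, exists2 p : {poly k}, p != 0 & operator_horner p v = 0.
Proof.
split=> H v.
  have [W [[m [b WE]] Wv phiW]] := H v.
  apply: (@linear_relation_in_span m b (fun i => iter i phi v)) => i.
  suff : W (iter i phi v) by rewrite WE.
  by elim: i => //= i IH; apply: phiW; exists (iter i phi v).
have [p p0 pv] := H v; pose s := (size p).-1.
have sE : size p = s.+1 by rewrite prednK // size_poly_gt0.
pose W := [set w | exists c : 'I_s -> k, w = \sum_(i < s) c i *: iter i phi v].
have W0 : W 0 by exists (fun=> 0); rewrite big1 // => i _; rewrite scale0r.
have WD a b c : W a -> W b -> W (c *: a + b).
  move=> [ca ->] [cb ->]; exists (fun i => c * ca i + cb i).
  by rewrite scaler_sumr -big_split; apply: eq_bigr => i _; rewrite scalerDl scalerA.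
have Wi i : (i <= s)%N -> W (iter i phi v).
  rewrite leq_eqVlt => /predU1P[->|lis].
    have ps : p`_s != 0 by rewrite -lead_coefE lead_coef_eq0.
    exists (fun i : 'I_s => - (p`_s)^-1 * p`_i).
    move: pv; rewrite /operator_horner sE big_ord_recr /= => /eqP.
    rewrite addrC addr_eq0 => /eqP E.
    rewrite -[LHS]scale1r -(mulVf ps) -scalerA E scalerN -scaleNr scaler_sumr.
    by apply: eq_bigr => i' _; rewrite scalerA.
  exists (fun j : 'I_s => (j == i :> nat)%:R).
  rewrite (bigD1 (Ordinal lis)) //= eqxx scale1r big1 ?addr0 // => j ji.
  by rewrite -[(j == i :> nat)]/(j == Ordinal lis) (negPf ji) scale0r.
exists W; split; [by exists s, (fun i => iter i phi v) | exact: (Wi 0%N) |].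
move=> _ [_ [c ->] <-]; rewrite raddf_sum.
elim/big_ind: _ => // [a b Wa Wb|i _]; first by rewrite -[a]scale1r; exact: WD.
by rewrite /= linearZZ -[X in W X]addr0; apply: WD => //; exact: (Wi i.+1).
Qed.

End OperatorPolynomials.

Section UnipotentPowers.
Variables (k : fieldType) (n : nat).
Hypothesis k0 : [pchar k] =i pred0.
Local Notation P := {mpoly k[n]}.
Local Notation aut := (polyaut n k).

Lemma poly_eq0_nat (r : {poly k}) : (forall m : nat, r.[m%:R] = 0) -> r = 0.
Proof.
have /pcharf0P kn0 := k0; move=> r0; apply/eqP; apply: contraT => rn0.
have := @max_poly_roots _ r [seq i%:R | i <- iota 0 (size r)] rn0.
rewrite size_map size_iota ltnn; apply.
  by apply/allP => _ /mapP[i _ ->]; apply/rootP.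
rewrite map_inj_uniq ?iota_uniq // => i j /eqP.
wlog le_ij : i j / (i <= j)%N => [W|].
  by case: (leqP i j) => [/W//|/ltnW/W + ij]; rewrite eq_sym => /(_ ij) ->.
rewrite eq_sym -subr_eq0 -natrB // kn0 subn_eq0 => ji.
by apply/eqP; rewrite eqn_leq le_ij.
Qed.

Lemma binomial_poly (j : nat) : exists r : {poly k}, forall m : nat, ('C(m, j))%:R = r.[m%:R].
Proof.
have /pcharf0P kn0 := k0; have fact0 : (j`!)%:R != 0 :> k by rewrite kn0 -lt0n fact_gt0.
suff [r rE] : exists r : {poly k}, forall m : nat, (m ^_ j)%:R = r.[m%:R].
  exists ((j`!)%:R^-1 *: r) => m; rewrite hornerZ -rE -bin_ffact natrM.
  by rewrite mulrCA mulVf ?mulr1.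
elim: j {fact0} => [|j [r rE]]; first by exists 1 => m; rewrite ffactn0 hornerC.
exists (r * ('X - j%:R%:P)) => m; rewrite hornerM hornerXsubC -rE ffactnSr natrM.
have [jm|mj] := leqP j m; first by rewrite natrB.
by rewrite ffact_small // !mul0r.
Qed.

(** Binomial expansion of a power of identity plus nilpotent, cut off at [d]. *)
Lemma iter_unipotent (V : lmodType k) (phi : {linear V -> V}) d m (v : V) :
  iter d (phi \- idfun) v = 0 ->
  iter m phi v = \sum_(j < d) ('C(m, j))%:R *: iter j (phi \- idfun) v.
Proof.
elim: m v => [|m IH] v dv.
  case: d dv => [/= ->|d _]; first by rewrite big_ord0.
  rewrite big_ord_recl bin0 scale1r big1 ?addr0 // => i _.
  by rewrite bin0n scale0r.
have phiE : phi v = v + (phi \- idfun) v by rewrite /= addrC subrK.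
have iterDm (a b : V) : iter m phi (a + b) = iter m phi a + iter m phi b.
  by elim: (m) => //= i ->; rewrite raddfD.
rewrite iterSr phiE iterDm IH // (IH ((phi \- idfun) v)); last first.
  by rewrite -iterSr iterS dv raddf0.
case: d dv {IH} => [|d] dv; first by rewrite !big_ord0 addr0.
rewrite big_ord_recl [X in _ + X]big_ord_recr [RHS]big_ord_recl /=.
rewrite -iterSr dv scaler0 addr0 -addrA !bin0; congr (_ + _).
rewrite -big_split; apply: eq_bigr => i _ /=.
by rewrite -iterSr -scalerDl binS natrD.
Qed.

Lemma expg_iter (phi : aut) m (f : P) : (phi ^+ m)%g f = iter m phi f.
Proof. by elim: m => [|m IH]; rewrite ?expg0 // expgS /= IH. Qed.

(** The coordinates of [phi ^+ m] are polynomials in [m], by the binomial expansion. Hence the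
    degree is bounded, and a closed set missing some power confines the others to the zeros of a
    nonzero polynomial in [m]; a product of two such polynomials cannot vanish at all natural
    numbers. *)
Lemma identity_piece_powers (D : {linear P -> P}) (phi : aut) :
  AutD D phi -> locally_nilpotent (phi \- idfun) ->
  identity_piece D [set psi | exists m, psi = (phi ^+ m)%g].
Proof.
move=> phiD nil; pose nu : {linear P -> P} := phi \- idfun.
have [d nud] : exists d, forall i : 'I_n, iter d nu 'X_i = 0.
  pose d i := projT1 (cid (nil 'X_i)).
  have dP i : iter (d i) nu 'X_i = 0 := projT2 (cid (nil 'X_i)).
  exists (\max_i d i) => i; rewrite -(subnK (leq_bigmax i)) iterD dP.
  by elim: (_ - _)%N => // j IHj; rewrite iterS IHj raddf0.
have powE m (i : 'I_n) : (phi ^+ m)%g 'X_i = \sum_(j < d) ('C(m, j))%:R *: iter j nu 'X_i.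
  by rewrite expg_iter; exact: iter_unipotent.
have [p phip] : exists p, forall m, aut_deg p (phi ^+ m)%g.
  exists (\max_(i < n) \max_(j < d) msize (iter j nu 'X_i)) => m i.
  rewrite powE; apply: leqW; apply: leq_trans (msize_sum _ _ _) _.
  apply: leq_trans (leq_bigmax i); apply/bigmax_leqP => j _.
  exact: leq_trans (msizeZ_le _ _) (leq_bigmax j).
split.
- by exists 0%N; rewrite expg0.
- by move=> _ [m ->]; elim: m => [|m IH]; rewrite ?expg0 // expgS; exact: AutDM.
- by exists p => _ [m ->].
have coordE j : exists r : {poly k}, forall m, @aut_coord n k p (phi ^+ m)%g j = r.[m%:R].
  pose b l := projT1 (cid (binomial_poly l)).
  have bE l m : ('C(m, l))%:R = (b l).[m%:R] := projT2 (cid (binomial_poly l)) m.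
  exists (\sum_(l < d) (iter l nu 'X_(enum_val j).1)@_(enum_val j).2 *: b l) => m.
  rewrite /aut_coord powE raddf_sum horner_sum; apply: eq_bigr => l _ /=.
  by rewrite mcoeffZ hornerZ bE mulrC.
have evalE (Q : {mpoly k[coord_dim n p]}) :
    exists r : {poly k}, forall m, Q.@[@aut_coord n k p (phi ^+ m)%g] = r.[m%:R].
  pose c j := projT1 (cid (coordE j)).
  have cE j m : @aut_coord n k p (phi ^+ m)%g j = (c j).[m%:R] := projT2 (cid (coordE j)) m.
  exists (mmap polyC c Q) => m; rewrite mevalE /mmap horner_sum; apply: eq_bigr => x _.
  rewrite hornerM hornerC; congr (_ * _); rewrite /mmap1 horner_prod.
  by apply: eq_bigr => i _; rewrite horner_exp cE.
move=> A B cA cB AB.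
have [SA SAE] := closed_bounded_zeros p cA; have [SB SBE] := closed_bounded_zeros p cB.
have witness (C : set aut) S : (forall psi, aut_deg p psi ->
    C psi <-> forall Q, S Q -> Q.@[@aut_coord n k p psi] = 0) ->
    ~ [set psi | exists m, psi = (phi ^+ m)%g] `<=` C ->
    exists2 r : {poly k}, r != 0 & forall m, C (phi ^+ m)%g -> r.[m%:R] = 0.
  move=> SE /existsNP[_ /not_implyP[[m ->] nC]].
  have [Q SQ Qm] : exists2 Q, S Q & Q.@[@aut_coord n k p (phi ^+ m)%g] != 0.
    apply: contrapT => noQ; apply: nC; apply/(SE _ (phip m)) => Q SQ.
    by apply: contrapT => /eqP Qm; apply: noQ; exists Q.
  have [r rE] := evalE Q; exists r.
    by apply: contra Qm => /eqP r0; rewrite rE r0 horner0.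
  by move=> m' /(SE _ (phip m'))/(_ Q SQ); rewrite rE.
apply: contrapT => /not_orP[/(witness A SA SAE)[rA rA0 rAE] /(witness B SB SBE)[rB rB0 rBE]].
have : rA * rB = 0.
  apply: poly_eq0_nat => m; rewrite hornerM.
  by have [/rAE->|/rBE->] := AB _ (ex_intro _ m erefl); rewrite ?mul0r ?mulr0.
by move=> /eqP; rewrite mulf_eq0 (negPf rA0) (negPf rB0).
Qed.

End UnipotentPowers.

(** * Automorphisms commuting with a simple derivation *)

Section Automorphisms.
Variables (n : nat).

Lemma locally_finite_bounded_powers (k : fieldType) (phi : polyaut n k) p :
  (forall m, aut_deg p (phi ^+ m)%g) -> locally_finite phi.
Proof.
move=> phip; apply/locally_finiteP => v.
have [[d dP] _] := regular_poly_app p v.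
pose B := {: 'X_{1..n < d}}.
apply: (@linear_relation_in_span _ _ #|B| (fun b => 'X_[(enum_val b : B)])
  (fun m => iter m phi v)) => m.
exists (fun b => (iter m phi v)@_(enum_val b : B)).
have /mpolywE {1}-> : (msize (iter m phi v) <= d)%N by rewrite -expg_iter; exact: dP.
rewrite (reindex (fun b : 'I_#|B| => enum_val b : B)) //.
by apply: onW_bij; exact: enum_val_bij.
Qed.

Lemma AutD_eigenvalue (k : fieldType) (D : {linear {mpoly k[n]} -> {mpoly k[n]}})
    (phi : polyaut n k) (l : k) (w : {mpoly k[n]}) :
  [pchar k] =i pred0 -> is_derivation D -> is_simple D -> AutD D phi ->
  w != 0 -> phi w = l *: w -> l = 1.
Proof.
move=> k0 derD simpleD phiD w0 phiw; pose P := {mpoly k[n]}.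
pose eig (s : seq (P * P)) := forall x, x \in s -> phi x.2 = l *: x.2.
have eig_cat s t : eig s -> eig t -> eig (s ++ t).
  by move=> es et x; rewrite mem_cat => /orP[/es|/et].
(* The ideal generated by the eigenvectors for [l]; it is [D]-stable by the Leibniz rule, because
   [D] commutes with [phi] and preserves the eigenspace. *)
pose I : set P := [set g | exists2 s, eig s & g = \sum_(x <- s) x.1 * x.2].
have idI : is_ideal I.
  split; first by exists [::]; rewrite ?big_nil.
    move=> _ _ [s es ->] [t et ->]; exists (s ++ t); first exact: eig_cat.
    by rewrite big_cat.
  move=> a _ [s es ->]; exists [seq (a * x.1, x.2) | x <- s].
    by move=> _ /mapP[x /es xs ->].
  by rewrite big_map mulr_sumr; apply: eq_bigr => x _; rewrite mulrA.
have [|I0|IT] := simpleD I idI.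
- move=> _ [g [s es ->] <-].
  exists ([seq (D x.1, x.2) | x <- s] ++ [seq (x.1, D x.2) | x <- s]).
    apply: eig_cat => _ /mapP[x /es xs ->] //=.
    by rewrite phiD xs linearZZ.
  rewrite big_cat /= !big_map -big_split raddf_sum; apply: eq_bigr => x _ /=.
  exact: derD.
- have : I w by exists [:: (1, w)]; [move=> x; rewrite inE => /eqP -> | rewrite big_seq1 mul1r].
  by rewrite I0 => /= wE; rewrite wE eqxx in w0.
have [s es s1] : I 1 by rewrite IT.
apply: (@eigenvalue_eq1 k n (fun i => phi 'X_i) (fun i => (phi^-1)%g 'X_i) l (size s)
  (fun j => (tnth (in_tuple s) j).2) (fun j => (tnth (in_tuple s) j).1)) => //.
- by move=> i; rewrite -polyaut_mmap; exact: polyautVK.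
- by move=> j; rewrite -polyaut_mmap es // mem_tnth.
by rewrite s1 [RHS]big_tnth.
Qed.

(** Split an annihilating polynomial of [v] into linear factors. A factor with root other than 1
    acts injectively by [AutD_eigenvalue] and can be removed; the others give a power of
    [phi \- idfun] killing [v]. *)
Lemma AutD_unipotent (k : closedFieldType) (D : {linear {mpoly k[n]} -> {mpoly k[n]}})
    (phi : polyaut n k) :
  [pchar k] =i pred0 -> is_derivation D -> is_simple D -> AutD D phi ->
  locally_finite phi -> unipotent phi.
Proof.
move=> k0 derD simpleD phiD lf; split=> // v.
have [p p0 pv] := (locally_finiteP phi).1 lf v.
have [r pE] := closed_field_poly_normal p.
pose nu : {linear {mpoly k[n]} -> {mpoly k[n]}} := phi \- idfun.
have iterB m a b : iter m nu (a - b) = iter m nu a - iter m nu b.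
  by elim: m => //= m ->; rewrite !raddfB /=; ring.
have iter_phi m a : iter m nu (phi a) = phi (iter m nu a).
  by elim: m => // m IH; rewrite !iterS IH /= raddfB.
have iterZ m c a : iter m nu (c *: a) = c *: iter m nu a.
  by elim: m => // m IH; rewrite !iterS IH linearZZ.
have : iter 0 nu (operator_horner phi (\prod_(z <- r) ('X - z%:P)) v) = 0.
  apply/eqP; move/eqP: pv; rewrite {1}pE operator_hornerZ scaler_eq0 lead_coef_eq0.
  by rewrite (negPf p0).
(* The generalized exponent counts the factors with root 1 already moved out of the product. *)
move: (0%N); elim: r {pE} => [|z r IH] m.
  rewrite big_nil (@operator_hornerE _ _ _ 1) ?size_poly1 // big_ord1 coef1 scale1r.
  by move=> mv; exists m.
rewrite big_cons operator_hornerXsubC; set u := operator_horner _ _ _.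
have [->|z1] := eqVneq z 1.
  by rewrite scale1r -[phi u - u]/(nu u) -iterSr; exact: IH.
rewrite iterB iter_phi iterZ => /eqP; rewrite subr_eq0 => /eqP uE.
apply: (IH m); apply/eqP; apply: contraT => u0.
by case/eqP: z1; exact: (AutD_eigenvalue k0 derD simpleD phiD u0 uE).
Qed.

Section ClosureGroup.
Variables (k : fieldType) (phi : polyaut n k).
Local Notation H := (gen_subgroup phi).

Lemma gen_subgroup1 : H 1%g.
Proof. by exists 0%N; left. Qed.

Lemma gen_subgroup_mul x y : H x -> H y -> H (x * y)%g.
Proof.
have mulr z : H z -> H (z * phi)%g.
  move=> [[|m] [->|->]]; first by exists 1%N; left; rewrite mul1g.
  - by exists 1%N; left; rewrite invg1 mul1g.
  - by exists m.+2; left; rewrite -expgSr.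
  - by exists m; right; rewrite expgS invMg mulgVK.
have mulV z : H z -> H (z * phi^-1)%g.
  move=> [[|m] [->|->]]; first by exists 1%N; right; rewrite mul1g.
  - by exists 1%N; right; rewrite invg1 mul1g.
  - by exists m; left; rewrite expgSr mulgK.
  - by exists m.+2; right; rewrite [in RHS]expgS invMg.
move=> Hx [m [->|->]]; elim: m => [|m IH].
- by rewrite mulg1.
- by rewrite expgSr mulgA; exact: mulr.
- by rewrite invg1 mulg1.
by rewrite expgS invMg mulgA; exact: mulV.
Qed.

(* For inverses: the closed sets x^j K, for x in the closure K, are           *)
(* descending, so x^j K = x^(j+1) K for some j and x^-1 is in K.              *)
Lemma closure_gen_subgroup_algebraic p :
  closure H `<=` @aut_deg n k p -> is_algebraic_group (closure H).
Proof.
move=> Hp; set K := closure H; have cK : closed K by exact: closed_closure.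
have HK : H `<=` K by exact: subset_closure.
have minK C : closed C -> H `<=` C -> K `<=` C.
  by move=> cC /closure_subset; rewrite -(closure_id C).1.
have cL x (C : set (polyaut n k)) : closed C -> closed [set y | C (x * y)%g].
  move=> cC; rewrite (_ : mkset _ = [set y | C (x * y * 1)%g]).
    exact: closed_translate.
  by apply/seteqP; split=> y /=; rewrite mulg1.
have cR y (C : set (polyaut n k)) : closed C -> closed [set x | C (x * y)%g].
  move=> cC; rewrite (_ : mkset _ = [set x | C (1 * x * y)%g]).
    exact: closed_translate.
  by apply/seteqP; split=> x /=; rewrite mul1g.
(* Closure under products in two stages, one factor at a time, since only translations are known to
   be continuous. *)
have KH x y : K x -> H y -> K (x * y)%g.
  move=> Kx Hy; move: x Kx; apply: (minK _ (cR y _ cK)) => x Hx.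
  exact/HK/gen_subgroup_mul.
have KM x y : K x -> K y -> K (x * y)%g.
  move=> Kx; move: y; apply: (minK _ (cL x _ cK)) => y Hy; exact: KH.
have K1 : K 1%g by exact/HK/gen_subgroup1.
have KX x j : K x -> K (x ^+ j)%g.
  by move=> Kx; elim: j => [|j IH]; rewrite ?expg0 // expgS; exact: KM.
have KV x : K x -> K x^-1%g.
  move=> Kx; pose A j := [set y | K (x ^- j * y)%g].
  have [j|j y Ay|j y Ay|j /(_ (x ^+ j)%g)] := @descending_closed_stabilize _ _ p A.
  - exact: cL.
  - by apply: Hp; rewrite -(mulKVg (x ^+ j)%g y); apply: KM => //; exact: KX.
  - by have := KM _ _ Kx Ay; rewrite expgSr invMg mulgA mulKVg.
  by rewrite /A /= mulVg expgSr invMg -mulgA mulVg mulg1; apply.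
split; [|exact: cK | by exists p].
split; first exact/mem_set.
by move=> x y /set_mem Kx /set_mem Ky; apply/mem_set; apply: KM => //; exact: KV.
Qed.

End ClosureGroup.

End Automorphisms.

Section ConnectedAutD.
Variables (k : closedFieldType) (n : nat).
Hypothesis k0 : [pchar k] =i pred0.
Variable D : {linear {mpoly k[n]} -> {mpoly k[n]}}.
Hypotheses (derD : is_derivation D) (simpleD : is_simple D).

Lemma AutD_algebraic_group p : AutD D `<=` @aut_deg n k p -> is_algebraic_group (AutD D).
Proof.
move=> Dp; split; [split | exact: closed_AutD | by exists p].
  exact/mem_set/AutD1.
by move=> x y /set_mem xD /set_mem yD; apply/mem_set/AutDM => //; exact: AutDV.
Qed.

(** The powers of [x] form an irreducible set containing 1 and [x], so a relatively open and closed
    subset contains both or neither. *)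
Lemma connected_of_unipotent :
  (forall phi : polyaut n k, AutD D phi -> unipotent phi) -> connected (AutD D).
Proof.
move=> uni B [b Bb] [O oO BO] [C cC BC].
have piece x : AutD D x -> identity_piece D [set y | exists m, y = (x ^+ m)%g].
  by move=> xD; apply: identity_piece_powers => //; case: (uni x xD).
have closure_piece x : AutD D x -> B x \/ B 1%g -> B x /\ B 1%g.
  move=> xD Bx1; have [X1 XD _ irrX] := piece x xD.
  have Xx : [set y | exists m, y = (x ^+ m)%g] x by exists 1%N; rewrite expg1.
  have [||XC|XO] := irrX C (~` O) cC; first by rewrite closedC.
  - move=> y /XD yD; have [By|nBy] := pselect (B y).
      by left; move: By; rewrite BC => -[].
    by right=> Oy; apply: nBy; rewrite BO.
  - by rewrite BC; split; split=> //; exact: XC.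
  by case: Bx1; rewrite BO => -[_]; [case/(XO _ Xx) | case/(XO _ X1)].
apply/seteqP; split=> x; first by rewrite BO => -[].
move=> xD; apply: (closure_piece x xD _).1; right.
by apply: (closure_piece b _ (or_introl Bb)).2; move: Bb; rewrite BO => -[].
Qed.

Lemma unipotent_of_bounded p : AutD D `<=` @aut_deg n k p ->
  forall phi : polyaut n k, AutD D phi -> unipotent phi.
Proof.
move=> Dp phi phiD; apply: AutD_unipotent => //.
apply: (@locally_finite_bounded_powers _ _ _ p) => m; apply: Dp.
by elim: m => [|m IH]; [exact: AutD1 | rewrite expgS; exact: AutDM].
Qed.

End ConnectedAutD.

Theorem corollary3p6 (k : closedFieldType) (hk : [pchar k] =i pred0) (n : nat)
    (D : {linear {mpoly k[n]} -> {mpoly k[n]}})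
    (hD : is_derivation D) (hsimple : is_simple D) :
  [<-> is_algebraic_group (AutD D);
       connected (AutD D);
       (forall phi : polyaut n k, AutD D phi -> is_algebraic_aut phi);
       (forall phi : polyaut n k, AutD D phi -> locally_finite phi);
       (forall phi : polyaut n k, AutD D phi -> unipotent phi)].
Proof.
tfae.
- move=> [_ _ [p Dp]]; apply: connected_of_unipotent => //.
  exact: unipotent_of_bounded Dp.
(* Connectedness bounds the degrees on [AutD D], which is closed and so contains the closure of the
   powers of [phi]. *)
- move=> /connected_AutD_bounded-/(_ hD hsimple)[p Dp] phi phiD.
  apply: (@closure_gen_subgroup_algebraic _ _ _ p).
  apply: subset_trans Dp; rewrite (closure_id (AutD D)).1; last exact: closed_AutD.
  apply: closure_subset => _ [m [->|->]]; last apply: AutDV.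
    by elim: m => [|m IH]; [exact: AutD1 | rewrite expgS; exact: AutDM].
  by elim: m => [|m IH]; [exact: AutD1 | rewrite expgS; exact: AutDM].
- move=> alg phi phiD; have [_ _ [p Hp]] := alg phi phiD.
  apply: (@locally_finite_bounded_powers _ _ _ p) => m.
  by apply/Hp/subset_closure; exists m; left.
- by move=> lf phi phiD; apply: (AutD_unipotent hk hD) => //; exact: lf.
(* Each [phi] lies in the piece formed by its own powers, so [AutD D] is contained in the bounded
   set [AutD0]. *)
move=> uni; have [q Dq] := AutD0_bounded hD hsimple.
apply: (@AutD_algebraic_group _ _ _ hD q) => phi phiD; apply: Dq.
exists [set psi | exists m, psi = (phi ^+ m)%g]; last by exists 1%N; rewrite expg1.
by apply: identity_piece_powers => //; case: (uni phi phiD).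
Qed.
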